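(* Let $(T_n)_{n\ge1}$ be a sequential dynamical system on $[0,1]$ such that all maps $T_n$ belong to a class $\mathcal{C}$ of piecewise expanding maps that satisfies $(D_r)$ (for some $r\ge1$) and (Dec), and for which the condition (Min) holds. Then there exists $C>0$ such that for all $t>0$ and all $n\ge1$, $$m\left(\kappa(\mathcal{E}_n,m_n)>\frac{t}{\sqrt n}\right)\le2e^{-Ct^2}.$$
   Context: $m$ is Lebesgue measure on $[0,1]$ with its Borel $\sigma$-algebra. A piecewise expanding map is a map $T:[0,1]\to[0,1]$ with $\inf_x|T'(x)|>1$ for which there is a finite partition $\mathcal{A}_T$ of $[0,1]$ into intervals with disjoint interiors such that $T$ can be extended to a $C^2$ map on a neighborhood of each element of $\mathcal{A}_T$. Its transfer operator $P_T:L^1(m)\to L^1(m)$ is characterized by $\int P_Tf\cdot g\,dm=\int f\cdot g\circ T\,dm$ for $f\in L^1(m)$, $g\in L^\infty(m)$. For $f\in L^1(m)$, $\mathrm{V}f$ is the infimum of the total variations on $[0,1]$ of the functions $\bar f$ with $\bar f=f$ $m$-a.e.; $\mathrm{BV}=\{f\in L^1(m):\mathrm{V}f<\infty\}$ with norm $\|f\|_{\mathrm{BV}}=\mathrm{V}f+\|f\|_{L^1_m}$. $(D_r)$: a class $\mathcal{C}$ of piecewise expanding maps satisfies $(D_r)$, $r\ge1$ an integer, if there are constants $0<\rho_r<1$, $M_0>0$, $C_r>0$ such that $\|P_Tf\|_{\mathrm{BV}}\le M_0\|f\|_{\mathrm{BV}}$ for all $T\in\mathcal{C}$, $f\in\mathrm{BV}$,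 and $\|P_{T_r}\cdots P_{T_1}f\|_{\mathrm{BV}}\le\rho_r\|f\|_{\mathrm{BV}}+C_r\|f\|_{L^1_m}$ for all $T_1,\ldots,T_r\in\mathcal{C}$, $f\in\mathrm{BV}$. (Dec): $\mathcal{C}$ satisfies (Dec) if there exist $0<\theta<1$ and $K_0>0$ such that for all $l\ge1$, all $T_1,\ldots,T_l\in\mathcal{C}$ and all $f\in\mathrm{BV}$ with $\int f\,dm=0$, $\|P_{T_l}\cdots P_{T_1}f\|_{\mathrm{BV}}\le K_0\theta^l\|f\|_{\mathrm{BV}}$. For a sequence $(T_n)_{n\ge1}$ and $n\le k$: $T_n^k=T_k\circ\cdots\circ T_n$, $P_n^k=P_{T_k}\cdots P_{T_n}$, and $T_1^0=\mathrm{Id}$. (Min): the sequence $(T_n)$ satisfies (Min) if there is $\delta>0$ with $P_1^n\mathbf{1}\ge\delta$ ($m$-a.e.) for all $n\ge1$. For $x\in[0,1]$ and $n\ge1$, the empirical measure is $\mathcal{E}_n(x)=\frac1n\sum_{k=0}^{n-1}\delta_{T_1^kx}$, and $m_n=\frac1n\sum_{k=0}^{n-1}(T_1^k)_\star m$ (average of the push-forwards of $m$). The Kantorovich distance between probability measures $\mu_1,\mu_2$ on $[0,1]$ is $\kappa(\mu_1,\mu_2)=\int_0^1|F_{\mu_1}(t)-F_{\mu_2}(t)|\,dt$ with $F_{\mu_i}(t)=\mu_i([0,t])$; $\kappa(\mathcal{E}_n,m_n)$ denotes the function $x\mapsto\kappa(\mathcal{E}_n(x),m_n)$. *)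

(* Defs.v *)
From HB Require Import structures.
From mathcomp Require Import all_boot all_order all_algebra.
From mathcomp Require Import all_classical all_reals all_analysis.
Set Implicit Arguments.
Unset Strict Implicit.
Unset Printing Implicit Defensive.
Import Order.TTheory GRing.Theory Num.Theory.
Import numFieldNormedType.Exports.
Local Open Scope classical_set_scope.
Local Open Scope ring_scope.

(* Maps and functions on [0, 1] are represented by functions R -> R whose      *)
(* values outside [0, 1] are irrelevant: every notion below only looks at      *)
(* their restriction to [0, 1].                                                *)

Section SequentialDynamics.
Context {R : realType}.
Implicit Types (f g h T : R -> R) (Ts : nat -> R -> R) (C : set (R -> R)).

Local Notation I := (`[0, 1]%classic : set R).
Local Notation mu := (@lebesgue_measure R).

Definition m : set R -> \bar R := mrestr mu (measurable_itv `[0%R, 1%R]).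

Definition C2_on (U : set R) g : Prop := forall x, U x ->
  [/\ derivable g x 1, derivable (derive1 g) x 1 & {for x, continuous (derive1n 2 g)}].

(* The elements of the partition are the closed intervals [p.1, p.2] between   *)
(* consecutive points of 0 = a_0 < a_1 < ... < a_N = 1.  The C^2 extension is  *)
(* only required to agree with T on the interior of the element, so that T may *)
(* jump (and take any value of [0, 1]) at the points a_i.  T' is considered    *)
(* wherever it exists in ]0, 1[, hence at all but finitely many points.        *)
Definition piecewise_expanding T : Prop :=
  [/\ forall x, I x -> I (T x),
      1 < inf [set `|derive1 T x| | x in [set x | 0 < x < 1 /\ derivable T x 1]] &
      exists2 s : seq R, itv_partition 0 1 s &
        forall p, p \in zip (0 :: s) s ->
          exists (U : set R) g,
            [/\ open U, `[p.1, p.2]%classic `<=` U, C2_on U g &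
                forall x, x \in `]p.1, p.2[ -> g x = T x]].

Definition L1 f : Prop := mu.-integrable I (EFin \o f).

Definition Linfty g : Prop := measurable_fun I g /\
  exists M : R, {ae mu, forall x, I x -> `|g x| <= M}.

Definition L1norm f : \bar R := (\int[mu]_(x in I) `|f x|%:E)%E.

Definition is_transfer T f h : Prop := L1 h /\ forall g, Linfty g ->
  (\int[mu]_(x in I) (h x * g x)%:E = \int[mu]_(x in I) (f x * g (T x))%:E)%E.

(* A representative of P_T f; it is determined up to a.e. equality, and all    *)
(* uses of it below are invariant under a.e. equality on [0, 1].               *)
Definition transfer T f : R -> R := xget (cst 0) [set h | is_transfer T f h].

Definition V f : \bar R := ereal_inf
  [set total_variation 0 1 fbar | fbar in
    [set fbar : R -> R | {ae mu, forall x, I x -> fbar x = f x}]].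

Definition BV f : Prop := L1 f /\ (V f < +oo)%E.

Definition BVnorm f : \bar R := (V f + L1norm f)%E.

(* T_n^k = T_k \o ... \o T_n; the identity for k = n - 1.                      *)
Definition Tcomp Ts (n k : nat) (x : R) : R :=
  foldl (fun y i => Ts i y) x (index_iota n k.+1).

(* P_n^k = P_{T_k} ... P_{T_n}                                                 *)
Definition Pcomp Ts (n k : nat) f : R -> R :=
  foldl (fun h i => transfer (Ts i) h) f (index_iota n k.+1).

Definition Dr (r : nat) C : Prop :=
  exists rho M0 Cr : R,
    [/\ 0 < rho < 1, 0 < M0, 0 < Cr,
        forall T f, C T -> BV f ->
          (BVnorm (transfer T f) <= M0%:E * BVnorm f)%E &
        forall Ts f, (forall i, (1 <= i <= r)%N -> C (Ts i)) -> BV f ->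
          (BVnorm (Pcomp Ts 1 r f) <= rho%:E * BVnorm f + Cr%:E * L1norm f)%E].

Definition Dec C : Prop :=
  exists theta K0 : R,
    [/\ 0 < theta < 1, 0 < K0 &
        forall (l : nat) Ts f, (1 <= l)%N ->
          (forall i, (1 <= i <= l)%N -> C (Ts i)) ->
          BV f -> (\int[mu]_(x in I) (f x)%:E = 0)%E ->
          (BVnorm (Pcomp Ts 1 l f) <= (K0 * theta ^+ l)%:E * BVnorm f)%E].

Definition Min Ts : Prop :=
  exists2 delta : R, 0 < delta &
    forall n : nat, (1 <= n)%N ->
      {ae mu, forall x, I x -> delta <= Pcomp Ts 1 n (cst 1) x}.

(* Plain set functions, since the iterates need not be measurable off [0, 1];  *)
(* kantorovich only evaluates them on the intervals [0, t].                    *)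
Definition empirical Ts (n : nat) (x : R) : set R -> \bar R := fun A =>
  ((n%:R^-1)%:E * \sum_(0 <= k < n) \d_(Tcomp Ts 1 k x) A)%E.

Definition mean_law Ts (n : nat) : set R -> \bar R := fun A =>
  ((n%:R^-1)%:E * \sum_(0 <= k < n) pushforward m (Tcomp Ts 1 k) A)%E.

Definition kantorovich (mu1 mu2 : set R -> \bar R) : \bar R :=
  (\int[mu]_(t in I) `|mu1 `[0%R, t]%classic - mu2 `[0%R, t]%classic|)%E.

End SequentialDynamics.

(* Main.v *)
Require Import Defs.
From HB Require Import structures.
From mathcomp Require Import all_boot all_order all_algebra.
From mathcomp Require Import all_classical all_reals all_analysis.
From mathcomp Require Import measurable_realfun ring lra.
Set Implicit Arguments.
Unset Strict Implicit.
Unset Printing Implicit Defensive.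
Import Order.TTheory GRing.Theory Num.Theory.
Import numFieldNormedType.Exports.
Local Open Scope classical_set_scope.
Local Open Scope ring_scope.

(* Let h_k = P_1^k 1. By (Min), h_k >= delta, so every T_k is nonsingular and all
   transfers exist. For fixed s put phi_k = 1_{[0,s]} - m(T_1^k <= s); (Dec)
   bounds G_k = sum_{j<k} P_{j+1}^k (phi_j h_j) uniformly, and with H_k = G_k / h_k
     psi_k = phi_k + H_k - H_{k+1} o T_{k+1}
   composed with T_1^k is a bounded reverse martingale difference, while the sums
   of phi_k o T_1^k and of psi_k o T_1^k differ by at most sup |H|. Hence the
   centred empirical distribution function at s has Gaussian exponential moments,
   uniformly in s. Since the Kantorovich distance is an average over s of its
   absolute values, Jensen's and Markov's inequalities and Tonelli conclude,
   with no separate estimate of the mean of the distance. *)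

(** Transfers are obtained in a forced order. The default of [transfer] is 0, so a.e. positivity of
    h_{k+1}, the chosen transfer of h_k, certifies that h_k has one. Testing this duality on a null
    set, with h_k >= delta, makes T_{k+1} nonsingular. Radon-Nikodym then provides a transfer for
    every integrable function, in particular for the signed phi_j h_j.

    The form of psi_k comes from G_{k+1} = P_{T_{k+1}}(G_k + phi_k h_k). Divided by densities, this
    says that H_{k+1} o T_{k+1} is the conditional expectation of phi_k + H_k given the future
    orbit: Gordin's martingale approximation with time reversed. Uniformity in s holds because
    1_{[0,s]} has variation at most 1 for every s.

    The coboundary leaves a prefactor e^(lam B), whereas the final bound allows only the factor 2,
    which is already spent on e^|y| <= e^y + e^(-y). Hence the split at t = 4B: below it the claimed
    bound is at least 1; above it the term lam B is absorbed by the Gaussian exponent. *)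

Local Notation I01 := (`[0, 1]%classic).
Local Notation leb := lebesgue_measure.

(** * Almost everywhere statements and integrable functions on the unit interval *)

Section UnitInterval.
Context {R : realType}.
Implicit Types (f g h : R -> R) (T : R -> R).

Local Notation I := (I01 : set R).
Local Notation mu := (@lebesgue_measure R).

Lemma measurable_I : measurable I.
Proof. exact: measurable_itv. Qed.
Hint Resolve measurable_I : core.

Lemma mu_I : mu I = 1%E.
Proof. by rewrite lebesgue_measure_itv/= lte_fin ltr01 oppr0 adde0. Qed.

Lemma ae_I (P : R -> Prop) : (forall x, I x -> P x) -> {ae mu, forall x, I x -> P x}.
Proof. exact: (@aeW _ (measurableTypeR R) _ mu). Qed.

Lemma ae_I1 (P Q : R -> Prop) : (forall x, I x -> P x -> Q x) ->
  {ae mu, forall x, I x -> P x} -> {ae mu, forall x, I x -> Q x}.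
Proof.
move=> PQ; have F := ae_filter_ringOfSetsType mu.
by apply: filterS => x Px Ix; exact/PQ/Px.
Qed.

Lemma ae_I2 (P Q S : R -> Prop) : (forall x, I x -> P x -> Q x -> S x) ->
  {ae mu, forall x, I x -> P x} -> {ae mu, forall x, I x -> Q x} ->
  {ae mu, forall x, I x -> S x}.
Proof.
move=> PQ; have F := ae_filter_ringOfSetsType mu.
by apply: filterS2 => x Px Qx Ix; exact: (PQ _ Ix (Px Ix) (Qx Ix)).
Qed.

Definition bounded_meas g :=
  measurable_fun I g /\ exists M, forall x, I x -> `|g x| <= M.

Lemma L1_measurable f : L1 f -> measurable_fun I f.
Proof. by move/(measurable_int mu)/measurable_EFinP. Qed.

Lemma bounded_meas_cst c : bounded_meas (cst c).
Proof. by split; [exact: measurable_cst | exists `|c|]. Qed.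

Lemma bounded_measD f g : bounded_meas f -> bounded_meas g ->
  bounded_meas (fun x => f x + g x).
Proof.
move=> [mf [M fM]] [mg [N gN]]; split; first exact: measurable_funD.
by exists (M + N) => x Ix; rewrite (le_trans (ler_normD _ _))// lerD ?fM ?gN.
Qed.

Lemma bounded_measM f g : bounded_meas f -> bounded_meas g ->
  bounded_meas (fun x => f x * g x).
Proof.
move=> [mf [M fM]] [mg [N gN]]; split; first exact: measurable_funM.
by exists (M * N) => x Ix; rewrite normrM ler_pM ?fM ?gN.
Qed.

Lemma bounded_measN f : bounded_meas f -> bounded_meas (fun x => - f x).
Proof.
move=> [mf [M fM]]; split; first exact: measurableT_comp.
by exists M => x Ix; rewrite normrN fM.
Qed.

Lemma bounded_meas_expR f : bounded_meas f -> bounded_meas (fun x => expR (f x)).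
Proof.
move=> [mf [M fM]]; split; first exact: measurableT_comp.
exists (expR M) => x Ix; rewrite ger0_norm ?expR_ge0// ler_expR.
exact: le_trans (ler_norm _) (fM _ Ix).
Qed.

Lemma bounded_meas_indic (A : set R) : measurable A -> bounded_meas (\1_A).
Proof.
move=> mA; split; first exact: measurable_indic.
by exists 1 => x _; rewrite indicE; case: (_ \in _); rewrite ?normr1 ?normr0.
Qed.

Lemma bounded_meas_comp g T : measurable_fun I T -> (forall x, I x -> I (T x)) ->
  bounded_meas g -> bounded_meas (g \o T).
Proof.
move=> mT TI [mg [M gM]]; split; last by exists M => x Ix; apply: gM; exact: TI.
by apply: (measurable_comp measurable_I) mg mT => _ [x Ix <-]; exact: TI.
Qed.

Lemma bounded_meas_Linfty g : bounded_meas g -> Linfty g.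
Proof. by move=> [mg [M gM]]; split => //; exists M; exact: ae_I. Qed.

Lemma L1_bounded g : bounded_meas g -> L1 g.
Proof.
move=> [mg [M gM]]; apply: measurable_bounded_integrable => //.
  by rewrite [ltLHS]mu_I ltry.
by exists M; split; rewrite ?num_real// => x Mx y Iy; exact: le_trans (gM _ Iy) (ltW Mx).
Qed.

Lemma L1M f g : L1 f -> bounded_meas g -> L1 (fun x => f x * g x).
Proof.
move=> Lf [mg [M gM]].
apply: (@integrableMl _ _ _ mu I measurable_I (EFin \o f) g Lf mg).
by exists M; split; rewrite ?num_real// => x Mx y Iy; exact: le_trans (gM _ Iy) (ltW Mx).
Qed.

Lemma L1D f g : L1 f -> L1 g -> L1 (fun x => f x + g x).
Proof. by move=> Lf Lg; exact: (@integrableD _ _ _ mu I measurable_I _ _ Lf Lg). Qed.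

Lemma L1Z c f : L1 f -> L1 (fun x => c * f x).
Proof. by move=> Lf; exact: (@integrableZl _ _ _ mu I measurable_I c _ Lf). Qed.

Lemma L1_ae f g : L1 f -> measurable_fun I g ->
  {ae mu, forall x, I x -> f x = g x} -> L1 g.
Proof.
move=> /integrableP[mf fi] mg fg; apply/integrableP; split; first exact/measurable_EFinP.
suff <- : (\int[mu]_(x in I) `|(f x)%:E| = \int[mu]_(x in I) `|(g x)%:E|)%E by [].
apply: (@ae_eq_integral _ _ _ mu I) => //.
- exact: measurableT_comp.
- by apply: measurableT_comp => //; exact/measurable_EFinP.
- by apply: ae_I1 fg => x Ix ->.
Qed.

Lemma ae_Rintegral f g : measurable_fun I f -> measurable_fun I g ->
  {ae mu, forall x, I x -> f x = g x} ->
  \int[mu]_(x in I) f x = \int[mu]_(x in I) g x.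
Proof.
move=> mf mg fg; congr fine; apply: (@ae_eq_integral _ _ _ mu I) => //.
- exact/measurable_EFinP.
- exact/measurable_EFinP.
- by apply: ae_I1 fg => x Ix ->.
Qed.

Lemma L1_RintegralE f : L1 f ->
  (\int[mu]_(x in I) (f x)%:E)%E = (\int[mu]_(x in I) f x)%:E.
Proof. by move=> Lf; rewrite fineK//; exact: (@integrable_fin_num _ _ _ mu I). Qed.

Lemma Rintegral_cstI c : \int[mu]_(x in I) c = c.
Proof. by rewrite (@Rintegral_cst _ _ _ mu I)// [X in fine X]mu_I mulr1. Qed.

Lemma ae_le_Rintegral f g : L1 f -> L1 g ->
  {ae mu, forall x, I x -> f x <= g x} ->
  \int[mu]_(x in I) f x <= \int[mu]_(x in I) g x.
Proof.
move=> Lf Lg fg; have [mf mg] := (L1_measurable Lf, L1_measurable Lg).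
(* Monotonicity of the integral is applied to a pointwise inequality, so [g] is replaced by
   [f \max g], which equals it a.e. *)
have mfg : measurable_fun I (f \max g) by exact: measurable_maxr.
have gE : {ae mu, forall x, I x -> g x = (f \max g) x}.
  by apply: ae_I1 fg => x _ fg; rewrite /= max_r.
rewrite (ae_Rintegral mg mfg gE); apply: (@le_Rintegral _ _ _ mu I) => //.
- exact: L1_ae gE.
- by move=> x _; rewrite /= le_max lexx.
Qed.

Lemma L1norm_Rintegral f : L1 f -> L1norm f = (\int[mu]_(x in I) `|f x|)%:E.
Proof. by move=> Lf; rewrite -L1_RintegralE//; exact: (@integrable_norm _ _ _ mu I). Qed.

Lemma ae_ex (P : R -> Prop) : {ae mu, forall x, I x -> P x} -> exists2 x, I x & P x.
Proof.
move=> aeP; apply: contrapT => nP.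
have : {ae mu, forall x, I x -> False}.
  by apply: ae_I1 aeP => x Ix Px; apply: nP; exists x.
move=> [N [mN N0 IN]].
have : (mu I <= mu N)%E.
  by apply: le_measure; rewrite ?inE// => x Ix; apply: IN => /=; exact.
by rewrite [leLHS]mu_I N0 lee_fin ler10.
Qed.

End UnitInterval.
#[global] Hint Resolve measurable_I : core.

(** * Density of the image of an absolutely continuous measure *)

Section ImageDensity.
Context {R : realType}.
Local Notation TR := (measurableTypeR R).
Local Notation mu := (@lebesgue_measure R).
Variables (f : TR -> R) (T : TR -> TR).
Hypotheses (f_ge0 : forall x, 0 <= f x) (int_f : mu.-integrable setT (EFin \o f)).
Hypothesis mT : measurable_fun setT T.
Local Open Scope ereal_scope.
Local Open Scope charge_scope.

Definition density_measure (A : set TR) : \bar R := \int[mu]_(x in A) (f x)%:E.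

Let density0 : density_measure set0 = 0.
Proof. exact: integral_set0. Qed.

Let density_ge0 A : 0 <= density_measure A.
Proof. by apply: integral_ge0 => x _; rewrite lee_fin. Qed.

Let density_sigma_additive : semi_sigma_additive density_measure.
Proof.
apply: (@semi_sigma_additive_nng_induced _ _ _ mu (EFin \o f)).
- exact: measurable_int int_f.
- by move=> x; rewrite lee_fin.
Qed.

HB.instance Definition _ := isMeasure.Build _ _ _ density_measure
  density0 density_ge0 density_sigma_additive.

Let density_fin : fin_num_fun density_measure.
Proof.
by move=> A mA; apply: (@integrable_fin_num _ _ _ mu A) => //; exact: integrableS int_f.
Qed.

HB.instance Definition _ := @Measure_isFinite.Build _ _ _ density_measure density_fin.

Definition image_density : set TR -> \bar R := pushforward density_measure T.

HB.instance Definition _ := Measure.copy image_density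
  (measure_function_pushforward__canonical__measure_function_Measure density_measure mT).

Let image_fin : fin_num_fun image_density.
Proof. by move=> A mA; apply: density_fin; rewrite -[X in measurable X]setTI; exact: mT. Qed.

HB.instance Definition _ := @Measure_isFinite.Build _ _ _ image_density image_fin.

(** Turns the derivative produced by the change of variables below back into [f]. *)
Lemma density_measure_RN :
  ae_eq mu setT ('d (charge_of_finite_measure density_measure) '/d mu) (EFin \o f).
Proof.
have dom : charge_of_finite_measure density_measure `<< mu.
  apply/null_content_dominatesP => A mA A0.
  apply: null_set_integral => //.
  by apply: measurable_funTS; exact: measurable_int int_f.
apply: integral_ae_eq => //.
- exact: Radon_Nikodym_integrable.
- exact: measurable_int int_f.
- by move=> E _ mE; rewrite -Radon_Nikodym_integral.
Qed.

Let bounded_finite_integrable (nu : {finite_measure set TR -> \bar R}) (g : TR -> R) :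
  measurable_fun setT g -> (exists M, forall x, (`|g x| <= M)%R) ->
  nu.-integrable setT (EFin \o g).
Proof.
move=> mg [M gM]; apply: measurable_bounded_integrable => //.
  by rewrite -ge0_fin_numE// fin_num_measure.
by exists M; split; rewrite ?num_real// => x Mx y _; exact: le_trans (gM _) (ltW Mx).
Qed.

(** [h] is the Radon-Nikodym derivative of the image under [T] of the measure with density [f]; the
    hypothesis is the absolute continuity of that image. *)
Lemma image_density_exists :
  (forall A : set TR, measurable A -> mu A = 0 -> density_measure (T @^-1` A) = 0) ->
  exists h : TR -> R, mu.-integrable setT (EFin \o h) /\
    forall g : TR -> R, measurable_fun setT g -> (exists M, forall x, (`|g x| <= M)%R) ->
    \int[mu]_x (h x * g x)%:E = \int[mu]_x (f x * g (T x))%:E.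
Proof.
move=> null; have dom : charge_of_finite_measure image_density `<< mu.
  by apply/null_content_dominatesP => A mA A0; exact: null.
have domf : charge_of_finite_measure density_measure `<< mu.
  apply/null_content_dominatesP => A mA A0.
  apply: null_set_integral => //.
  by apply: measurable_funTS; exact: measurable_int int_f.
set rn := 'd (charge_of_finite_measure image_density) '/d mu.
have rnE x : (fine (rn x))%:E = rn x by rewrite fineK//; exact: Radon_Nikodym_fin_num.
exists (fine \o rn); split.
  by apply: eq_integrable (Radon_Nikodym_integrable dom) => // x _; rewrite /= rnE.
move=> g mg gM.
have mgT : measurable_fun setT (g \o T) by exact: measurableT_comp.
have gTM : exists M, forall x, (`|(g \o T) x| <= M)%R by case: gM => M gM; exists M => x; exact: gM.
transitivity (\int[mu]_x ((EFin \o g) x * rn x)).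
  by apply: eq_integral => x _; rewrite EFinM /= rnE muleC.
rewrite (@Radon_Nikodym_change_of_variables _ _ _ image_density mu dom _ setT)//; last first.
  exact: bounded_finite_integrable.
transitivity (\int[density_measure]_x (EFin \o (g \o T)) x).
  apply: (@integral_pushforward _ _ _ _ _ T mT density_measure setT) => //.
    exact/measurable_EFinP.
  exact: (@bounded_finite_integrable density_measure (g \o T)).
rewrite -(@Radon_Nikodym_change_of_variables _ _ _ density_measure mu domf _ setT)//; last first.
  exact: bounded_finite_integrable.
apply: ae_eq_integral => //.
- apply: emeasurable_funM; first exact/measurable_EFinP.
  exact: measurable_int (Radon_Nikodym_integrable domf).
- apply/measurable_EFinP/measurable_funM => //.
  by apply/measurable_EFinP; exact: (measurable_int mu int_f).
- have F := ae_filter_ringOfSetsType mu.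
  by apply: filterS density_measure_RN => x /= + _ => ->//; rewrite EFinM muleC.
Qed.

End ImageDensity.

(** * The duality relation between a function and its transfer *)

Section TransferRelation.
Context {R : realType}.
Implicit Types (f g h : R -> R) (T : R -> R).

Local Notation I := (I01 : set R).
Local Notation mu := (@lebesgue_measure R).

(** Truncation to [-B, B]: turns an a.e. bound into a bound at every point without changing the a.e.
    class. *)
Definition clamp (B y : R) := Num.max (- B) (Num.min B y).

Lemma clamp_bound B y : 0 <= B -> `|clamp B y| <= B.
Proof.
move=> B0; rewrite ler_norml /clamp le_max lexx/= ge_max ge_min lexx/= andbT.
by rewrite (le_trans _ B0)// oppr_le0.
Qed.

Lemma clamp_id B y : `|y| <= B -> clamp B y = y.
Proof. by rewrite ler_norml => /andP[? ?]; rewrite /clamp min_r// max_r. Qed.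

Lemma measurable_clamp B f : measurable_fun I f ->
  measurable_fun I (fun x => clamp B (f x)).
Proof.
move=> mf; apply: measurable_maxr; first exact: measurable_cst.
by apply: measurable_minr; first exact: measurable_cst.
Qed.

Lemma bounded_meas_clamp B f : 0 <= B -> measurable_fun I f ->
  bounded_meas (fun x => clamp B (f x)).
Proof.
by move=> B0 mf; split; [exact: measurable_clamp|exists B => x _; exact: clamp_bound].
Qed.

Definition selfmap T := measurable_fun I T /\ forall x, I x -> I (T x).

Definition nonsingular T :=
  forall A : set R, measurable A -> mu A = 0%E -> mu (I `&` T @^-1` A) = 0%E.

Lemma selfmap_comp T g : selfmap T -> bounded_meas g -> bounded_meas (fun x => g (T x)).
Proof. by move=> [mT TI]; exact: bounded_meas_comp. Qed.

Lemma ae_comp T (P : R -> Prop) : selfmap T -> nonsingular T ->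
  {ae mu, forall x, I x -> P x} -> {ae mu, forall x, I x -> P (T x)}.
Proof.
move=> [mT TI] nT [N [mN N0 PN]].
exists (I `&` T @^-1` N); split; [exact: mT|exact: nT|].
move=> x /= /not_implyP[Ix nP]; split => //.
by apply: PN => /= H; apply: nP; apply: H; exact: TI.
Qed.

(** Relational form of h = P_T f, tested only on everywhere bounded functions. It can be added,
    multiplied and altered on null sets without passing through the choice made by [transfer].
    Integrability is included because [fine] sends an infinite integral to 0. *)
Definition transfers T f h := [/\ L1 f, L1 h & forall g, bounded_meas g ->
  \int[mu]_(x in I) (h x * g x) = \int[mu]_(x in I) (f x * g (T x))].

Lemma is_transfer_transfers T f h : L1 f -> is_transfer T f h -> transfers T f h.
Proof.
move=> Lf [Lh fh]; split => // g bg.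
by congr fine; apply: fh; exact: bounded_meas_Linfty.
Qed.

Lemma transfers_is_transfer T f h : selfmap T -> nonsingular T ->
  transfers T f h -> is_transfer T f h.
Proof.
move=> sT nT [Lf Lh fh]; split => // g [mg [M gM]].
(* The bound on [g] holds only a.e.; the truncation is an admissible test function, and
   nonsingularity carries the a.e. equality through [T]. *)
pose g' x := clamp `|M| (g x).
have bg' : bounded_meas g' by exact: bounded_meas_clamp.
have mgT : measurable_fun I (fun x => g (T x)).
  by apply: (measurable_comp measurable_I _ mg sT.1) => _ [x Ix <-]; exact: sT.2.
have gg' : {ae mu, forall x, I x -> g' x = g x}.
  by apply: ae_I1 gM => x Ix gM; rewrite /g' clamp_id// (le_trans gM)// ler_norm.
transitivity (\int[mu]_(x in I) (h x * g' x)%:E)%E.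
  apply: (@ae_eq_integral _ _ _ mu I) => //.
  - by apply/measurable_EFinP/measurable_funM => //; exact: L1_measurable.
  - apply/measurable_EFinP/measurable_funM => //; first exact: L1_measurable.
    by case: bg'.
  - by apply: ae_I1 gg' => x Ix ->.
transitivity (\int[mu]_(x in I) (f x * g' (T x))%:E)%E; last first.
  apply: (@ae_eq_integral _ _ _ mu I) => //.
  - apply/measurable_EFinP/measurable_funM => //; first exact: L1_measurable.
    by case: (selfmap_comp sT bg').
  - by apply/measurable_EFinP/measurable_funM => //; exact: L1_measurable.
  - by apply: ae_I1 (ae_comp sT nT gg') => x Ix ->.
rewrite !L1_RintegralE ?fh//; apply: L1M => //.
exact: selfmap_comp.
Qed.

Lemma transfers0 T : transfers T (cst 0) (cst 0).
Proof.
have L0 : L1 (cst 0 : R -> R) by exact/L1_bounded/bounded_meas_cst.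
by split => // g _; apply: eq_Rintegral => x _; rewrite !mul0r.
Qed.

Lemma transfersD T f1 h1 f2 h2 : selfmap T -> transfers T f1 h1 -> transfers T f2 h2 ->
  transfers T (fun x => f1 x + f2 x) (fun x => h1 x + h2 x).
Proof.
move=> sT [Lf1 Lh1 fh1] [Lf2 Lh2 fh2]; split; [exact: L1D|exact: L1D|move=> g bg].
under eq_Rintegral do rewrite mulrDl.
rewrite (@RintegralD _ _ _ mu I _ _ measurable_I); [|exact: L1M|exact: L1M].
have bgT := selfmap_comp sT bg.
rewrite fh1// fh2// -(@RintegralD _ _ _ mu I _ _ measurable_I); [|exact: L1M|exact: L1M].
by apply: eq_Rintegral => x _; rewrite mulrDl.
Qed.

Lemma transfers_sum T (f h : nat -> R -> R) n : selfmap T ->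
  (forall j, (j < n)%N -> transfers T (f j) (h j)) ->
  transfers T (fun x => \sum_(0 <= j < n) f j x) (fun x => \sum_(0 <= j < n) h j x).
Proof.
move=> sT; elim: n => [|n IH] fh.
  have -> : (fun x => \sum_(0 <= j < 0) f j x) = cst 0 by apply/funext => x; rewrite big_nil.
  have -> : (fun x => \sum_(0 <= j < 0) h j x) = cst 0 by apply/funext => x; rewrite big_nil.
  exact: transfers0.
have -> : (fun x => \sum_(0 <= j < n.+1) f j x) =
          (fun x => \sum_(0 <= j < n) f j x + f n x).
  by apply/funext => x; rewrite big_nat_recr.
have -> : (fun x => \sum_(0 <= j < n.+1) h j x) =
          (fun x => \sum_(0 <= j < n) h j x + h n x).
  by apply/funext => x; rewrite big_nat_recr.
by apply: transfersD => //; [apply: IH => j jn; apply: fh; exact: ltnW|exact: fh].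
Qed.

Lemma transfers_ae T f h f' h' : selfmap T -> transfers T f h ->
  measurable_fun I f' -> measurable_fun I h' ->
  {ae mu, forall x, I x -> f x = f' x} -> {ae mu, forall x, I x -> h x = h' x} ->
  transfers T f' h'.
Proof.
move=> sT [Lf Lh fh] mf' mh' ff' hh'.
split; [exact: L1_ae ff'|exact: L1_ae hh'|move=> g bg].
transitivity (\int[mu]_(x in I) (h x * g x)).
  apply: ae_Rintegral.
  - by apply: measurable_funM => //; case: bg.
  - by apply: measurable_funM; [exact: L1_measurable|case: bg].
  - by apply: ae_I1 hh' => x Ix ->.
rewrite fh//; apply: ae_Rintegral.
- by apply: measurable_funM; [exact: L1_measurable|case: (selfmap_comp sT bg)].
- by apply: measurable_funM => //; case: (selfmap_comp sT bg).
- by apply: ae_I1 ff' => x Ix ->.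
Qed.

(** The module property P_T(f . (g o T)) = g . P_T f, by testing against [g * u]. *)
Lemma transfersM T f h g : selfmap T -> bounded_meas g -> transfers T f h ->
  transfers T (fun x => f x * g (T x)) (fun x => h x * g x).
Proof.
move=> sT bg [Lf Lh fh]; split; [exact/L1M/selfmap_comp|exact: L1M|move=> u bu].
transitivity (\int[mu]_(x in I) (h x * (g x * u x))).
  by apply: eq_Rintegral => x _; rewrite mulrA.
rewrite (fh (fun x => g x * u x)); last exact: bounded_measM.
by apply: eq_Rintegral => x _; rewrite mulrA.
Qed.

(** Tested on the indicator of a null set A, the duality gives 0 = int f . (1_A o T) >= delta m(T^-1
    A). *)
Lemma transfers_nonsingular T f h (delta : R) : selfmap T -> 0 < delta ->
  {ae mu, forall x, I x -> delta <= f x} -> transfers T f h -> nonsingular T.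
Proof.
move=> sT d0 fd [Lf Lh fh] A mA A0.
have b1 : bounded_meas (\1_A : R -> R) by exact: bounded_meas_indic.
have hA : \int[mu]_(x in I) (h x * \1_A x) = 0.
  rewrite -[RHS](_ : \int[mu]_(x in I) 0 = 0); last by exact: Rintegral_cstI.
  apply: ae_Rintegral => //.
    by apply: measurable_funM; [exact: L1_measurable|case: b1].
  exists A; split => // x /= /not_implyP[Ix]; rewrite indicE => H.
  by apply/set_mem; apply: contra_notT H => /negPf ->; rewrite mulr0.
have bT : bounded_meas (fun x => \1_A (T x) : R) := selfmap_comp sT b1.
have mE : measurable (I `&` T @^-1` A) by exact: sT.1.
have : \int[mu]_(x in I) (delta * \1_A (T x)) <= \int[mu]_(x in I) (f x * \1_A (T x)).
  apply: ae_le_Rintegral.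
  - by apply: L1_bounded; apply: bounded_measM => //; exact: bounded_meas_cst.
  - exact: L1M.
  - by apply: ae_I1 fd => x _ fd; rewrite ler_wpM2r// indicE.
rewrite -fh// hA (@RintegralZl _ _ _ mu I)//; last exact: L1_bounded.
rewrite pmulr_rle0// => le0.
have -> : mu (I `&` T @^-1` A) = (\int[mu]_(x in I) (\1_A (T x) : R))%:E.
  rewrite -L1_RintegralE; last exact: L1_bounded.
  have -> : I `&` T @^-1` A = (I `&` T @^-1` A) `&` I by rewrite setIAC setIid.
  rewrite -(@integral_indic _ _ _ mu I measurable_I _ mE).
  apply: eq_integral => x /set_mem Ix; rewrite !indicE; congr (_%:R)%:E.
  by congr nat_of_bool; apply/idP/idP => /set_mem => [[_]|] H; apply/mem_set.
apply/eqP; rewrite eq_le lee_fin le0/= lee_fin.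
by apply: Rintegral_ge0 => x _; rewrite indicE.
Qed.

End TransferRelation.

(** * Existence of transfers; measurability of piecewise expanding maps *)

Section TransferExistence.
Context {R : realType}.
Implicit Types (f g h : R -> R) (T : R -> R).

Local Notation I := (I01 : set R).
Local Notation mu := (@lebesgue_measure R).

Let transfers_exists_ge0 T f : selfmap T -> nonsingular T -> L1 f ->
  (forall x, I x -> 0 <= f x) -> exists h, transfers T f h.
Proof.
move=> [mT TI] nT Lf f0.
(* Passage to the whole line by zero extension. The extended [T] sends the complement of [I] to the
   point 0, harmlessly, since the extended [f] puts no mass there. *)
have mT0 : measurable_fun setT (T \_ I) by exact/(measurable_restrictT _ measurable_I).
have f0_ge0 x : 0 <= (f \_ I) x.
  by rewrite patchE; case: ifPn => // /set_mem; exact: f0.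
have Lf0 : mu.-integrable setT (EFin \o f \_ I).
  by rewrite -restrict_EFin; apply/(@integrable_mkcond _ _ _ mu I).
have null (A : set (measurableTypeR R)) : measurable A -> mu A = 0%E ->
    density_measure (f \_ I) ((T \_ I) @^-1` A) = 0%E.
  move=> mA A0; have mB : measurable (I `&` T @^-1` A) by exact: mT.
  have mC : measurable ((T \_ I) @^-1` A).
    by rewrite -[X in measurable X]setTI; exact: mT0.
  rewrite /density_measure integral_mkcond.
  rewrite -[RHS](@null_set_integral _ _ _ mu _ (EFin \o f) mB); last first.
  - exact: nT.
  - by apply: measurable_funS (measurable_int mu Lf) => // x [].
  rewrite [RHS]integral_mkcond; apply: eq_integral => x _; rewrite !patchE.
  have [/set_mem Ix|nIx] := boolP (x \in I); last first.
    rewrite [in RHS]memNset; last by move=> [/mem_set]; rewrite (negPf nIx).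
    by case: ifP.
  congr (if _ then _ else _); apply/idP/idP => /set_mem.
  + by rewrite /= patchE mem_set// => TA; apply/mem_set; split.
  + by move=> [_ TA]; apply/mem_set; rewrite /= patchE mem_set.
have [h [Lh fh]] := image_density_exists f0_ge0 Lf0 mT0 null.
exists h; split => //; first exact: integrableS Lh.
move=> g [mg [M gM]].
have mg0 : measurable_fun setT (g \_ I) by exact/(measurable_restrictT _ measurable_I).
have g0M : exists M, forall x, `|(g \_ I) x| <= M.
  exists `|M| => x; rewrite patchE; case: ifPn => [/set_mem Ix|_].
    by rewrite (le_trans (gM _ Ix))// ler_norm.
  by rewrite normr0.
rewrite /Rintegral; congr fine.
transitivity (\int[mu]_x (h x * (g \_ I) x)%:E)%E.
  rewrite integral_mkcond; apply: eq_integral => x _; rewrite !patchE.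
  by case: ifP => _ //; rewrite mulr0.
rewrite fh// [RHS]integral_mkcond; apply: eq_integral => x _; rewrite !patchE.
case: ifPn => [/set_mem Ix|nIx]; last by rewrite mul0r.
by rewrite mem_set//; exact: TI.
Qed.

Lemma transfers_exists T f : selfmap T -> nonsingular T -> L1 f ->
  exists h, transfers T f h.
Proof.
move=> sT nT Lf; have mf := L1_measurable Lf.
have m0 : measurable_fun I (cst 0 : R -> R) by exact: measurable_cst.
have mNf : measurable_fun I (fun x => - f x) by exact: measurableT_comp.
have Lp : L1 (fun x => Num.max (f x) 0).
  apply: (@le_integrable _ _ _ mu I measurable_I _ (EFin \o f)) => //.
    by apply/measurable_EFinP; exact: (measurable_maxr mf m0).
  by move=> x _ /=; rewrite lee_fin; case: (lerP (f x) 0) => // _; rewrite normr0.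
have Ln : L1 (fun x => Num.max (- f x) 0).
  apply: (@le_integrable _ _ _ mu I measurable_I _ (EFin \o f)) => //.
    by apply/measurable_EFinP; exact: (measurable_maxr mNf m0).
  by move=> x _ /=; rewrite lee_fin -(normrN (f x)); case: (lerP (- f x) 0) => // _; rewrite normr0.
have [|hp fhp] := transfers_exists_ge0 sT nT Lp.
  by move=> x _; rewrite le_max lexx orbT.
have [|hn fhn] := transfers_exists_ge0 sT nT Ln.
  by move=> x _; rewrite le_max lexx orbT.
have fhn' := transfersM sT (bounded_meas_cst (- 1)) fhn.
exists (fun x => hp x + hn x * - 1).
have -> : f = (fun x => Num.max (f x) 0 + Num.max (- f x) 0 * -1).
  apply/funext => x; rewrite mulrN1; case: (lerP (f x) 0) => fx.
    by rewrite max_l ?oppr_ge0// opprK add0r.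
  by rewrite max_r ?oppr_le0 1?ltW// subr0.
exact: transfersD.
Qed.

Lemma transferP T f : selfmap T -> nonsingular T -> L1 f ->
  transfers T f (transfer T f).
Proof.
move=> sT nT Lf; apply: is_transfer_transfers => //.
apply: xgetPex; have [h fh] := transfers_exists sT nT Lf.
by exists h; exact: transfers_is_transfer.
Qed.

(* Where no transfer exists, [transfer] is the junk value 0. *)
Lemma transfer_neq0 T f : L1 f -> {ae mu, forall x, I x -> 0 < transfer T f x} ->
  transfers T f (transfer T f).
Proof.
move=> Lf pos; apply: is_transfer_transfers => //.
rewrite /transfer; case: xgetP => [h -> //|no].
move: pos; rewrite /transfer.
have -> : xget (cst 0) [set h | is_transfer T f h] = cst 0.
  by case: xgetP => // h _ /no.
by move=> /ae_ex[x _]; rewrite ltxx.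
Qed.

Lemma piecewise_expanding_selfmap T : piecewise_expanding T -> selfmap T.
Proof.
move=> [TI _ [s s01 smooth]]; split => //.
have {}smooth p : p \in zip (0 :: s) s -> measurable_fun `]p.1, p.2[%classic T.
  move=> /smooth[U [g [oU pU C2 gT]]].
  apply: (eq_measurable_fun g).
    by move=> x /set_mem/= xp; rewrite gT.
  apply: open_continuous_measurable_fun; first exact: interval_open.
  move=> x /set_mem /= xp; apply: differentiable_continuous.
  apply/derivable1_diffP.
  by have [] := C2 x (pU _ (subset_itv_oo_cc xp)).
(* Induction along the partition with a free left endpoint. Endpoints are handled as singletons
   because [T] agrees with its smooth extension only on the open pieces. *)
have path_measurable : forall (s : seq R) (a : R), path <%R a s ->
    (forall p, p \in zip (a :: s) s -> measurable_fun `]p.1, p.2[%classic T) ->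
    measurable_fun `[a, last a s]%classic T /\ a <= last a s.
  elim=> [a _ _|b t IH a /= /andP[ab bt] Hs]; first by rewrite /= set_itv1; split => //; exact: measurable_fun_set1.
  have [|mt bl] := IH b bt.
    by move=> p pt; apply: Hs; rewrite inE pt orbT.
  split; last exact: le_trans (ltW ab) bl.
  have -> : `[a, last b t]%classic =
      ([set a] `|` `]a, b[%classic) `|` `[b, last b t]%classic.
    apply/seteqP; split => x /=; rewrite !in_itv/=.
      move=> /andP[]; rewrite le_eqVlt => /predU1P[->|->]; first by move=> _; left; left.
      move=> ->; case: (ltP x b) => xb; first by left; right.
      by right.
    move=> [[->|/andP[ax xb]]|/andP[bx ->]].
    - by rewrite lexx (le_trans (ltW ab) bl).
    - by rewrite (ltW ax) (ltW (lt_le_trans xb bl)).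
    - by rewrite (le_trans (ltW ab) bx).
  apply/measurable_funU => //; first exact: measurableU.
  split => //; apply/measurable_funU => //; split.
    exact: measurable_fun_set1.
  by apply: (Hs (a, b)); rewrite inE eqxx.
case: s01 => s01 /eqP s1.
by have [] := path_measurable s 0 s01 smooth; rewrite s1.
Qed.

End TransferExistence.

(** * Functions of bounded variation *)

Section BoundedVariation.
Context {R : realType}.
Implicit Types (f g h : R -> R) (T : R -> R).

Local Notation I := (I01 : set R).
Local Notation mu := (@lebesgue_measure R).
Local Notation TV := (total_variation 0 1).

Lemma BVnorm_rep f (D : R) : L1 f -> (BVnorm f < D%:E)%E ->
  exists fbar v, [/\ {ae mu, forall x, I x -> fbar x = f x}, TV fbar = v%:E &
    v + \int[mu]_(x in I) `|f x| < D].
Proof.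
move=> Lf; rewrite /BVnorm L1norm_Rintegral//; set L := Rintegral _ _ _ => VD.
have : (V f < (D - L)%:E)%E.
  move: VD; case: (V f) => [v| |] //=; last by rewrite !ltNyr.
  by rewrite -EFinD !lte_fin ltrBrDr.
move=> /ereal_inf_lt[_ [fbar /= fbarE <-]].
have := @total_variation_ge0 _ 0 1 fbar ler01.
case E : (TV fbar) => [v| |] // v0; rewrite lte_fin => vD.
by exists fbar, v; split => //; rewrite -ltrBrDr.
Qed.

Lemma total_variation_dist f x y : I x -> I y -> (`|f x - f y|%:E <= TV f)%E.
Proof.
wlog xy : x y / x <= y => [H|] Ix Iy.
  by case: (leP x y) => [|/ltW] xy; [exact: H|rewrite distrC; exact: H].
move: Ix Iy => /=; rewrite !in_itv/= => /andP[x0 _] /andP[_ y1].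
rewrite distrC (le_trans (total_variation_ge f xy))//.
have x1 := le_trans xy y1.
rewrite (total_variationD f x0 x1) (total_variationD f xy y1).
by rewrite addeCA leeDl//; apply: adde_ge0; exact: total_variation_ge0.
Qed.

(** For a.e. y one has |fbar x| <= v + |f y|; integrating in y over an interval of length 1 gives
    the bound. *)
Lemma total_variation_sup f fbar v : L1 f -> {ae mu, forall x, I x -> fbar x = f x} ->
  TV fbar = v%:E -> forall x, I x -> `|fbar x| <= v + \int[mu]_(x in I) `|f x|.
Proof.
move=> Lf fE TVv x Ix.
have Ln : L1 (fun y => `|f y|) by exact: (@integrable_norm _ _ _ mu I).
have Lv : L1 (cst v) by exact/L1_bounded/bounded_meas_cst.
have Lx : L1 (cst `|fbar x|) by exact/L1_bounded/bounded_meas_cst.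
rewrite -[leLHS]Rintegral_cstI -[X in X + _]Rintegral_cstI -(@RintegralD _ _ _ mu I)//.
apply: ae_le_Rintegral => //; first exact: L1D.
apply: ae_I1 fE => y Iy fE; rewrite -lerBlDr -fE.
by rewrite (le_trans (lerB_dist _ _))// -lee_fin -TVv total_variation_dist.
Qed.

Lemma BVnorm_ae_bound f (D : R) : L1 f -> (BVnorm f < D%:E)%E ->
  {ae mu, forall x, I x -> `|f x| <= D}.
Proof.
move=> Lf /(BVnorm_rep Lf)[fbar [v [fE TVv vD]]].
apply: ae_I1 (fE) => x Ix <-; apply: le_trans (ltW vD).
exact: (total_variation_sup Lf fE TVv).
Qed.

Lemma total_variationM f g (M N v w : R) :
  (forall x, I x -> `|f x| <= M) -> (forall x, I x -> `|g x| <= N) ->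
  (TV f <= v%:E)%E -> (TV g <= w%:E)%E ->
  (TV (fun x => (f x * g x)%R) <= (M * w + N * v)%:E)%E.
Proof.
move=> fM gN TVf TVg; apply: ge_ereal_sup => _ [_ [s s01 <-] <-]; rewrite lee_fin.
have I0 : I 0 by rewrite /= in_itv/= lexx ler01.
have M0 : 0 <= M := le_trans (normr_ge0 _) (fM _ I0).
have N0 : 0 <= N := le_trans (normr_ge0 _) (gN _ I0).
have var u (c : R) : (TV u <= c%:E)%E -> variation 0 1 u s <= c.
  move=> uc; rewrite -lee_fin (le_trans _ uc)//.
  by apply: ereal_sup_ubound; exists (variation 0 1 u s) => //; exact: variations_variation.
apply: (@le_trans _ _ (M * variation 0 1 g s + N * variation 0 1 f s)); last first.
  by rewrite lerD// ler_wpM2l// var.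
rewrite /variation !mulr_sumr -big_split/= !big_nat.
apply: ler_sum => i /= si.
set x := nth 1 s i; set y := nth 1 (0 :: s) i.
have Ix : I x.
  by rewrite /= in_itv/= (@itv_partition_nth_ge _ _ _ _ s i.+1)//=
    (@itv_partition_nth_le _ _ 0 1 s i.+1).
have Iy : I y.
  by rewrite /= in_itv/= (@itv_partition_nth_ge _ _ _ _ s i)//=
    ?(@itv_partition_nth_le _ _ 0 1 s i)// ltnW.
have -> : f x * g x - f y * g y = f x * (g x - g y) + g y * (f x - f y) by ring.
by rewrite (le_trans (ler_normD _ _))// !normrM lerD// ler_wpM2r// ?fM ?gN.
Qed.

(** By the Leibniz rule the variation of the product is at most v + (v + L), as v + L bounds the
    representative of [f]; the L1 norm adds at most L. Hence the factor 2. *)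
Lemma BVnormM f g (D : R) : L1 f -> bounded_meas g ->
  (forall x, I x -> `|g x| <= 1) -> (TV g <= 1)%E ->
  (BVnorm f < D%:E)%E -> (BVnorm (fun x => (g x * f x)%R) < (2 * D)%:E)%E.
Proof.
move=> Lf bg g1 TVg /(BVnorm_rep Lf)[fbar [v [fE TVv vD]]].
have Lgf : L1 (fun x => g x * f x).
  by have := L1M Lf bg; under eq_fun do rewrite mulrC.
rewrite /BVnorm L1norm_Rintegral//; set L := Rintegral _ _ _ in vD.
have Vgf : (V (fun x => (g x * f x)%R) <= (1 * v + (v + L) * 1)%:E)%E.
  apply: ge_ereal_inf; exists (TV (fun x => g x * fbar x)).
    by exists (fun x => g x * fbar x) => //; apply: ae_I1 fE => x _ ->.
  apply: total_variationM => //; last by rewrite TVv.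
  exact: total_variation_sup.
apply: (le_lt_trans (leeD2r _ Vgf)); rewrite -EFinD lte_fin.
have LgfL : \int[mu]_(x in I) `|g x * f x| <= L.
  apply: (@le_Rintegral _ _ _ mu I) => //.
  - exact: (@integrable_norm _ _ _ mu I).
  - exact: (@integrable_norm _ _ _ mu I).
  - by move=> x Ix; rewrite normrM ler_piMl// g1.
lra.
Qed.

Lemma BVnorm_lty_BV f (D : R) : L1 f -> (BVnorm f < D%:E)%E -> BV f.
Proof.
move=> Lf fD; split => //; move: fD; rewrite /BVnorm L1norm_Rintegral//.
by case: (V f) => [v| |] //= _; rewrite ?ltry.
Qed.

Lemma BVnorm1 : (BVnorm (cst 1%R : R -> R) <= 1)%E.
Proof.
have L1 : L1 (cst 1 : R -> R) by exact/L1_bounded/bounded_meas_cst.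
rewrite /BVnorm L1norm_Rintegral//.
have -> : \int[mu]_(x in I) `|cst 1 x : R| = 1.
  by rewrite -[RHS]Rintegral_cstI; apply: eq_Rintegral => x _ /=; rewrite normr1.
rewrite -[leRHS]add0e leeD2r//.
apply: ge_ereal_inf; exists (TV (cst 1 : R -> R)).
  by exists (cst 1) => //; exact: ae_I.
by rewrite nondecreasing_total_variation ?subrr.
Qed.

(** On [I] this is the indicator of [0, s]. The half-line form is monotone in [x] and in [s], which
    yields both its variation and measurability in the parameter. *)
Definition step (s x : R) : R := (x <= s)%R%:R.

Lemma step_bound s x : 0 <= step s x <= 1.
Proof. by rewrite /step; case: (x <= s); rewrite /= ?lexx ?ler01. Qed.

Lemma measurable_step s : measurable_fun setT (step s).
Proof.
rewrite /step; have -> : (fun x : R => (x <= s)%R%:R : R) = \1_(`]-oo, s]%classic).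
  by apply/funext => x; rewrite indicE mem_setE in_itv.
exact: measurable_indic.
Qed.

Lemma bounded_meas_step s : bounded_meas (step s).
Proof.
split; first exact: measurable_funTS (measurable_step s).
by exists 1 => x _; have /andP[s0 s1] := step_bound s x; rewrite ger0_norm.
Qed.

Lemma mean_step_bound T s : selfmap T ->
  0 <= \int[mu]_(y in I) step s (T y) <= 1.
Proof.
move=> sT; apply/andP; split.
  by apply: Rintegral_ge0 => x _; have /andP[] := step_bound s (T x).
rewrite -[leRHS]Rintegral_cstI; apply: (@le_Rintegral _ _ _ mu I) => //.
- exact/L1_bounded/(selfmap_comp sT)/bounded_meas_step.
- exact/L1_bounded/bounded_meas_cst.
- by move=> x _; have /andP[] := step_bound s (T x).
Qed.

Lemma total_variation_step s (c : R) : (TV (fun x => (step s x - c)%R) <= 1)%E.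
Proof.
rewrite -total_variationN nondecreasing_total_variation//; last first.
  move=> x y _ _ xy; rewrite /= lerN2 lerD2r /step ler_nat.
  by case: (leP y s) => // ys; rewrite (le_trans xy ys).
rewrite lee_fin/=.
have /andP[_ H1] := step_bound s 0; have /andP[H0 _] := step_bound s 1.
lra.
Qed.

End BoundedVariation.

(** * Exponential moments of reverse martingale sums *)

Section ReverseMartingale.
Context {R : realType}.
Implicit Types (f g : R -> R) (T : R -> R) (Ts : nat -> R -> R).

Local Notation I := (I01 : set R).
Local Notation mu := (@lebesgue_measure R).

(** For a centred increment the linear term integrates to 0 and a Gaussian factor remains. If y >
    1/2 then y <= 2 y^2; otherwise e^y <= 1/(1 - y) <= 1 + y + 2 y^2. *)
Lemma expR_le_add_sqr (y : R) : expR y <= y + expR (2 * y ^+ 2).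
Proof.
have [y_le|y_gt] := lerP y 2^-1; last first.
  apply: (@le_trans _ _ (expR (2 * y ^+ 2))); last by rewrite lerDr; lra.
  by rewrite ler_expR; nra.
have y1 : 0 < 1 - y by lra.
have e1 : expR y * (1 - y) <= 1.
  rewrite -[leRHS](expRxMexpNx_1 y) ler_wpM2l ?expR_ge0//.
  exact: (expR_ge1Dx (- y)).
have e2 : 1 + 2 * y ^+ 2 <= expR (2 * y ^+ 2) by exact: (expR_ge1Dx (2 * y ^+ 2)).
have : expR y <= (1 - y)^-1 by rewrite -[leRHS]mul1r ler_pdivlMr.
have : (1 - y)^-1 <= 1 + y + 2 * y ^+ 2.
  by rewrite -[leLHS]mul1r ler_pdivrMr//; nra.
lra.
Qed.

Lemma TcompS Ts k x : Tcomp Ts 1 k.+1 x = Ts k.+1 (Tcomp Ts 1 k x).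
Proof. by rewrite /Tcomp /index_iota !subSS !subn0 -[X in iota _ X]addn1 iotaD foldl_cat. Qed.

Lemma Tcomp_shift Ts k x : Tcomp Ts 1 k.+1 x = Tcomp (fun i => Ts i.+1) 1 k (Ts 1%N x).
Proof. by elim: k => [//|k IH]; rewrite TcompS IH TcompS. Qed.

Lemma Tcomp_selfmap Ts k : (forall i, selfmap (Ts i.+1)) -> selfmap (Tcomp Ts 1 k).
Proof.
move=> sT; elim: k => [|k [mT TI]]; first by split => //; exact: measurable_id.
have [mTk TkI] := sT k.
have -> : Tcomp Ts 1 k.+1 = Ts k.+1 \o Tcomp Ts 1 k by apply/funext => x; rewrite TcompS.
split; last by move=> x Ix; apply: TkI; exact: TI.
by apply: (measurable_comp measurable_I) mTk mT => _ [x Ix <-]; exact: TI.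
Qed.

Lemma bounded_meas_sum (F : nat -> R -> R) n : (forall i, bounded_meas (F i)) ->
  bounded_meas (fun x => \sum_(0 <= i < n) F i x).
Proof.
move=> bF; elim: n => [|n IH].
  have -> : (fun x => \sum_(0 <= i < 0) F i x) = cst 0 by apply/funext => x; rewrite big_nil.
  exact: bounded_meas_cst.
have -> : (fun x => \sum_(0 <= i < n.+1) F i x) = (fun x => \sum_(0 <= i < n) F i x + F n x).
  by apply/funext => x; rewrite big_nat_recr.
exact: bounded_measD.
Qed.

(* Reverse-martingale form of Azuma's inequality: the vanishing integrals say
   that [psi k] composed with the orbit is centred given the future
   [T_1^(k+1), T_1^(k+2), ...], so the factors are peeled off from the front. *)
Lemma reverse_martingale_mgf n Ts (h psi : nat -> R -> R) (b lam : R) :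
  (forall k, selfmap (Ts k.+1)) -> (forall k, bounded_meas (psi k)) ->
  (forall k x, I x -> `|psi k x| <= b) ->
  (forall k x, I x -> 0 <= h k x) ->
  (forall k, transfers (Ts k.+1) (h k) (h k.+1)) ->
  (forall k u, bounded_meas u ->
    \int[mu]_(x in I) (h k x * psi k x * u (Ts k.+1 x)) = 0) ->
  \int[mu]_(x in I) (h 0%N x *
      expR (lam * \sum_(0 <= k < n) psi k (Tcomp Ts 1 k x)))
  <= expR (2 * (lam * b) ^+ 2 * n%:R) * \int[mu]_(x in I) h n x.
Proof.
elim: n Ts h psi => [|n IH] Ts h psi sT bpsi psib h0 Th psi0.
  rewrite mulr0 expR0 mul1r le_eqVlt; apply/orP; left; apply/eqP.
  by apply: eq_Rintegral => x _; rewrite big_nil mulr0 expR0 mulr1.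
pose Ts' i := Ts i.+1.
(* The remaining factors depend on the point only through its first image, so they form a test
   function both for [psi0] and for the duality. *)
pose g y := expR (lam * \sum_(0 <= k < n) psi k.+1 (Tcomp Ts' 1 k y)).
have bg : bounded_meas g.
  apply: bounded_meas_expR; apply: bounded_measM; first exact: bounded_meas_cst.
  apply: bounded_meas_sum => i; apply: selfmap_comp => //.
  by apply: Tcomp_selfmap => k; exact: sT.
have bgT : bounded_meas (fun x => g (Ts 1%N x)) by exact: (selfmap_comp (sT 0%N)).
have [Lh0 Lh1 hE] := Th 0%N.
pose c := expR (2 * (lam * b) ^+ 2).
have bexp k : bounded_meas (fun x => expR (lam * psi k x)).
  by apply: bounded_meas_expR; apply: bounded_measM => //; exact: bounded_meas_cst.
have := IH Ts' (fun k => h k.+1) (fun k => psi k.+1).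
move=> /(_ (fun k => sT k.+1) (fun k => bpsi k.+1) (fun k => psib k.+1)).
move=> /(_ (fun k => h0 k.+1) (fun k => Th k.+1) (fun k => psi0 k.+1)) IHn.
apply: (@le_trans _ _ (c * \int[mu]_(x in I) (h 1%N x * g x))); last first.
  have -> : expR (2 * (lam * b) ^+ 2 * n.+1%:R) = c * expR (2 * (lam * b) ^+ 2 * n%:R).
    by rewrite /c -expRD -natr1; congr expR; ring.
  by rewrite -mulrA ler_wpM2l// expR_ge0.
rewrite (hE _ bg).
have Lpsi : L1 (fun x => h 0%N x * psi 0%N x * g (Ts 1%N x)).
  by apply: L1M => //; exact: L1M.
have Lg : L1 (fun x => h 0%N x * g (Ts 1%N x)) by exact: L1M.
(* The inserted linear term vanishes by [psi0]; the claim becomes the pointwise bound e^y <= y + c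
   at y = lam psi_0(x). *)
have -> : c * \int[mu]_(x in I) (h 0%N x * g (Ts 1%N x)) =
    \int[mu]_(x in I) (lam * (h 0%N x * psi 0%N x * g (Ts 1%N x)) +
                       c * (h 0%N x * g (Ts 1%N x))).
  rewrite (@RintegralD _ _ _ mu I)//; [|exact: L1Z..].
  by rewrite !(@RintegralZl _ _ _ mu I)// (psi0 0%N g bg) mulr0 add0r.
apply: (@le_Rintegral _ _ _ mu I) => //.
- have -> : EFin \o (fun x => h 0%N x * expR (lam * \sum_(0 <= k < n.+1) psi k (Tcomp Ts 1 k x)))
      = EFin \o (fun x => h 0%N x * (expR (lam * psi 0%N x) * g (Ts 1%N x))).
    apply/funext => x /=; congr (_ * _)%:E.
    rewrite /g -expRD -mulrDr big_nat_recl//=; congr (expR (lam * (_ + _))).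
    by apply: eq_bigr => k _; rewrite Tcomp_shift.
  by apply: L1M => //; exact: bounded_measM.
- by apply: L1D; exact: L1Z.
move=> x Ix.
have -> : expR (lam * \sum_(0 <= k < n.+1) psi k (Tcomp Ts 1 k x)) =
    expR (lam * psi 0%N x) * g (Ts 1%N x).
  rewrite /g -expRD -mulrDr big_nat_recl//=; congr (expR (lam * (_ + _))).
  by apply: eq_bigr => k _; rewrite Tcomp_shift.
have E : expR (lam * psi 0%N x) <= lam * psi 0%N x + c.
  rewrite (le_trans (expR_le_add_sqr _))// lerD2l ler_expR ler_pM2l//.
  rewrite -real_normK ?num_real// -[leRHS]real_normK ?num_real//.
  rewrite ler_sqr ?nnegrE// !normrM ler_wpM2l// (le_trans (psib _ _ Ix))//.
  exact: ler_norm.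
have hg : 0 <= h 0%N x * g (Ts 1%N x) by rewrite mulr_ge0 ?h0 ?expR_ge0.
have := ler_wpM2l hg E; lra.
Qed.

End ReverseMartingale.

(** * Iterated transfers and auxiliary bounds *)

Section TransferIterates.
Context {R : realType}.
Implicit Types (f g : R -> R) (T : R -> R) (Ts : nat -> R -> R).

Local Notation I := (I01 : set R).
Local Notation mu := (@lebesgue_measure R).

Lemma PcompS Ts k f : Pcomp Ts 1 k.+1 f = transfer (Ts k.+1) (Pcomp Ts 1 k f).
Proof. by rewrite /Pcomp /index_iota !subSS !subn0 -[X in iota _ X]addn1 iotaD foldl_cat. Qed.

Lemma Pcomp_add Ts q l f :
  Pcomp Ts 1 (q + l) f = Pcomp (fun i => Ts (q + i)%N) 1 l (Pcomp Ts 1 q f).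
Proof. by elim: l => [|l IH]; [rewrite addn0|rewrite addnS !PcompS IH -addnS]. Qed.

Lemma ae_sum_bound (F : nat -> R -> R) (c : nat -> R) n :
  (forall j, (j < n)%N -> {ae mu, forall x, I x -> `|F j x| <= c j}) ->
  {ae mu, forall x, I x -> `|\sum_(0 <= j < n) F j x| <= \sum_(0 <= j < n) c j}.
Proof.
elim: n => [|n IH] Fc.
  by apply: ae_I => x _; rewrite !big_nil normr0.
apply: ae_I2 (IH (fun j jn => Fc j (ltnW jn))) (Fc n (ltnSn n)) => x _ Hn H.
by rewrite !big_nat_recr//= (le_trans (ler_normD _ _))// lerD.
Qed.

Lemma sum_geometric_le (theta : R) n : 0 < theta < 1 ->
  \sum_(0 <= j < n) theta ^+ (n - j) <= (1 - theta)^-1.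
Proof.
move=> /andP[t0 t1]; have t2 : 0 < 1 - theta by lra.
elim: n => [|n IH]; first by rewrite big_nil invr_ge0 ltW.
rewrite big_nat_recr//= subSnn expr1.
have -> : \sum_(0 <= i < n) theta ^+ (n.+1 - i) = theta * \sum_(0 <= i < n) theta ^+ (n - i).
  by rewrite mulr_sumr !big_nat; apply: eq_bigr => i /andP[_ /ltnW li]; rewrite subSn// exprS.
have : (1 - theta)^-1 * (1 - theta) = 1 by rewrite mulVf// gt_eqF.
have := ler_wpM2l (ltW t0) IH; lra.
Qed.

Lemma inv_max_measurable (delta : R) f : 0 < delta -> measurable_fun I f ->
  measurable_fun I (fun x => (Num.max delta (f x))^-1).
Proof.
move=> d0 mf; have mw : measurable_fun setT (fun y : R => (Num.max delta y)^-1).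
  apply: nonincreasing_measurable => // x y xy.
  by rewrite lef_pV2 ?posrE ?lt_max ?d0// le_max2.
exact: (measurableT_comp mw).
Qed.

End TransferIterates.

(** * Densities of the orbit and the martingale-coboundary decomposition *)

Section Decomposition.
Context {R : realType}.
Variables (C : set (R -> R)) (r : nat) (Ts : nat -> R -> R).
Hypotheses (C_expanding : forall T, C T -> piecewise_expanding T).
Hypotheses (r_gt0 : (1 <= r)%N) (C_Dr : Dr r C) (C_Dec : Dec C).
Hypotheses (Ts_C : forall n, (1 <= n)%N -> C (Ts n)).
Hypothesis Ts_Min : Min Ts.

Local Notation I := (I01 : set R).
Local Notation mu := (@lebesgue_measure R).

Let h k := Pcomp Ts 1 k (cst 1).
(** This is P_{j+1}^{j+l}, presented through a shifted sequence because (Dec) speaks of compositions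
    indexed from 1. *)
Let Q j l f := Pcomp (fun i => Ts (j + i)%N) 1 l f.

Let Ts_selfmap k : selfmap (Ts k.+1).
Proof. exact/piecewise_expanding_selfmap/C_expanding/Ts_C. Qed.

Let h_ge : exists2 delta : R, 0 < delta <= 1 &
  forall k, {ae mu, forall x, I x -> delta <= h k x}.
Proof.
(* The minimum with 1 covers k = 0, where the density is the constant 1. *)
have [delta d0 hd] := Ts_Min; exists (Num.min delta 1).
  by rewrite lt_min d0 ltr01 ge_min lexx orbT.
case=> [|k]; first by apply: ae_I => x _; rewrite /h /= ge_min lexx orbT.
by apply: ae_I1 (hd k.+1 isT) => x _ hx; rewrite ge_min hx.
Qed.

(** Integrability and duality go together: [h k.+1] is integrable as a transfer, and it is a genuine
    transfer because it is positive a.e. *)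
Let h_transfers k : transfers (Ts k.+1) (h k) (h k.+1).
Proof.
suff : L1 (h k) -> transfers (Ts k.+1) (h k) (h k.+1).
  apply; elim: k => [|k IH]; first exact/L1_bounded/bounded_meas_cst.
  have [delta /andP[d0 _] hd] := h_ge.
  rewrite /h PcompS -/(h k).
  suff [] : transfers (Ts k.+1) (h k) (transfer (Ts k.+1) (h k)) by [].
  apply: transfer_neq0 => //; rewrite -PcompS.
  by apply: ae_I1 (hd k.+1) => x _; exact: lt_le_trans.
move=> Lh; have [delta /andP[d0 _] hd] := h_ge.
rewrite /h PcompS -/(h k); apply: transfer_neq0 => //; rewrite -PcompS.
by apply: ae_I1 (hd k.+1) => x _; exact: lt_le_trans.
Qed.

Let h_L1 k : L1 (h k).
Proof. by have [] := h_transfers k. Qed.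

Let Ts_nonsingular k : nonsingular (Ts k.+1).
Proof.
have [delta /andP[d0 _] hd] := h_ge.
exact: transfers_nonsingular (Ts_selfmap k) d0 (hd k) (h_transfers k).
Qed.

Let Q_transfers j l f : L1 f -> transfers (Ts (j + l).+1) (Q j l f) (Q j l.+1 f).
Proof.
move=> Lf; suff LQ : L1 (Q j l f).
  by rewrite /Q PcompS addnS; exact: transferP.
elim: l => [//|l IH]; rewrite /Q PcompS addnS -/(Q j l f).
by have [] := transferP (Ts_selfmap (j + l)) (Ts_nonsingular (j + l)) IH.
Qed.

Let Q_L1 j l f : L1 f -> L1 (Q j l f).
Proof. by move=> Lf; have [] := Q_transfers j l Lf. Qed.

(** [h k] is the density of the law of T_1^k under [m]. *)
Let h_orbit k g : bounded_meas g ->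
  \int[mu]_(x in I) (h k x * g x) = \int[mu]_(x in I) g (Tcomp Ts 1 k x).
Proof.
elim: k g => [|k IH] g bg.
  by apply: eq_Rintegral => x _; rewrite /h /= mul1r.
have [_ _ ->//] := h_transfers k; rewrite IH; last exact: selfmap_comp.
by apply: eq_Rintegral => x _; rewrite TcompS.
Qed.

Let h_int k : \int[mu]_(x in I) h k x = 1.
Proof.
rewrite -[RHS]Rintegral_cstI -[RHS](h_orbit k (bounded_meas_cst 1)).
by apply: eq_Rintegral => x _; rewrite mulr1.
Qed.

Let h_L1norm k : L1norm (h k) = 1%E.
Proof.
have [delta /andP[d0 _] hd] := h_ge.
rewrite L1norm_Rintegral//; congr EFin; rewrite -[RHS](h_int k); apply: ae_Rintegral.
- by apply: measurableT_comp => //; exact: L1_measurable.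
- exact: L1_measurable.
- by apply: ae_I1 (hd k) => x _ hx; rewrite ger0_norm// (le_trans (ltW d0)).
Qed.

(** (D_r) contracts only blocks of [r] transfers. Powers of [M] control the indices below [r]; the
    others follow by induction in steps of [r], the L1 norm staying equal to 1. *)
Let h_BV : exists2 B : R, 0 < B & forall k, (BVnorm (h k) < B%:E)%E.
Proof.
have [rho [M0 [Cr [/andP[rho0 rho1] M00 Cr0 HM HD]]]] := C_Dr.
have rho2 : 0 < 1 - rho by lra.
pose M := Num.max 1 M0; have M1 : 1 <= M by rewrite /M le_max lexx.
(* [B] dominates M^k for k < r and satisfies rho B + Cr <= B, so the bound reproduces itself. *)
pose B := M ^+ r + Cr / (1 - rho).
have BV_h k (D : R) : (BVnorm (h k) <= D%:E)%E -> BV (h k).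
  move=> hD; apply: (@BVnorm_lty_BV _ _ (D + 1)) => //.
  by rewrite (le_lt_trans hD)// lte_fin ltrDl.
have first_r k : (BVnorm (h k) <= (M ^+ k)%:E)%E.
  elim: k => [|k IH]; first exact: BVnorm1.
  rewrite /h PcompS -/(h k).
  apply: (le_trans (HM _ _ (Ts_C (ltn0Sn k)) (BV_h _ _ IH))).
  apply: (@le_trans _ _ (M0%:E * (M ^+ k)%:E)%E).
    by rewrite lee_pmul2l// lte_fin.
  rewrite -EFinM lee_fin exprS ler_wpM2r// ?exprn_ge0//; first exact: le_trans M1.
  by rewrite /M le_max lexx orbT.
have q0 : 0 <= Cr / (1 - rho) by rewrite divr_ge0// ltW.
have qE : Cr / (1 - rho) * (1 - rho) = Cr by rewrite divfK// gt_eqF.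
have Mr : 1 <= M ^+ r by exact: exprn_ege1.
exists (B + 1) => [|k]; first by rewrite /B; lra.
apply: (@le_lt_trans _ _ B%:E); last by rewrite lte_fin ltrDl.
elim/ltn_ind: k => k IH; have [kr|rk] := ltnP k r.
  rewrite (le_trans (first_r k))// lee_fin /B -[leLHS]addr0 lerD//.
  by rewrite ler_weXn2l// ltnW.
have kE : k = (k - r + r)%N by rewrite subnK.
have kr : (k - r < k)%N by rewrite ltn_subrL r_gt0 (leq_trans r_gt0 rk).
have Hk := IH _ kr.
rewrite kE /h Pcomp_add -/(h (k - r)).
have Ci i : (1 <= i <= r)%N -> C (Ts (k - r + i)%N).
  by move=> /andP[i1 _]; apply: Ts_C; rewrite addn_gt0 i1 orbT.
apply: (le_trans (HD _ _ Ci (BV_h _ _ Hk))).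
rewrite h_L1norm mule1.
apply: (@le_trans _ _ (rho%:E * B%:E + Cr%:E)%E).
  by rewrite leeD2r// lee_pmul2l// lte_fin.
rewrite -EFinM -EFinD lee_fin /B.
have : 0 <= (1 - rho) * M ^+ r by rewrite mulr_ge0 ?exprn_ge0 ?ltW// (lt_le_trans _ M1).
lra.
Qed.

(** The BV norm dominates the essential supremum, so (Dec) becomes the sup estimate that will keep
    the H_k bounded. *)
Let Q_decay : exists theta K : R, [/\ 0 < theta < 1, 0 < K & forall j l f (D : R),
  (1 <= l)%N -> L1 f -> \int[mu]_(x in I) f x = 0 -> (BVnorm f < D%:E)%E ->
  {ae mu, forall x, I x -> `|Q j l f x| <= theta ^+ l * (K * D)}].
Proof.
have [theta [K [/andP[t0 t1] K0 HDec]]] := C_Dec.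
exists theta, K; rewrite t0 t1; split => // j l f D l1 Lf f0 fD.
apply: BVnorm_ae_bound; first exact: Q_L1.
have Ci i : (1 <= i <= l)%N -> C (Ts (j + i)%N).
  by move=> /andP[i1 _]; apply: Ts_C; rewrite addn_gt0 i1 orbT.
have f0E : (\int[mu]_(x in I) (f x)%:E = 0)%E by rewrite L1_RintegralE// f0.
apply: (le_lt_trans (HDec _ _ _ l1 Ci (BVnorm_lty_BV Lf fD) f0E)).
have -> : (theta ^+ l * (K * D))%:E = ((K * theta ^+ l)%:E * D%:E)%E.
  by rewrite -EFinM; congr EFin; ring.
rewrite lte_pmul2l// lte_fin.
by rewrite mulr_gt0// exprn_gt0.
Qed.

(** [|lam| * B] pays for the coboundary left after telescoping, and 1 + 2B bounds each increment.
    Neither depends on [s], since each [phi k] has sup norm and variation at most 1. *)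
Lemma orbit_mgf : exists2 B : R, 0 <= B & forall s lam n,
  \int[mu]_(x in I) expR (lam * \sum_(0 <= k < n) (step s (Tcomp Ts 1 k x) -
      \int[mu]_(y in I) step s (Tcomp Ts 1 k y)))
  <= expR (`|lam| * B + 2 * (lam * (1 + 2 * B)) ^+ 2 * n%:R).
Proof.
have [delta /andP[d0 d1] hd] := h_ge.
have [D D0 hD] := h_BV.
have [theta [K [t01 K0 HQ]]] := Q_decay.
have [t0 t1] := andP t01.
(* Sum of the geometric decay, with 2D bounding the BV norm of each [F k]. *)
pose B0 := (1 - theta)^-1 * (K * (2 * D)).
have B00 : 0 <= B0 by rewrite !mulr_ge0// ?invr_ge0; lra.
pose B := B0 / delta.
have B_ge0 : 0 <= B by rewrite divr_ge0// ltW.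
exists B => // s lam n.
have oT k : selfmap (Tcomp Ts 1 k) by exact: Tcomp_selfmap.
pose c k := \int[mu]_(y in I) step s (Tcomp Ts 1 k y).
have c01 k : 0 <= c k <= 1 by exact: mean_step_bound.
pose phi k x := step s x - c k.
have bphi k : bounded_meas (phi k).
  apply: bounded_measD; first exact: bounded_meas_step.
  exact/bounded_measN/bounded_meas_cst.
have phi1 k x : `|phi k x| <= 1.
  by rewrite ler_norml /phi; have /andP[] := step_bound s x; have /andP[] := c01 k; lra.
pose F k x := phi k x * h k x.
have LF k : L1 (F k).
  by have := L1M (h_L1 k) (bphi k); under eq_fun do rewrite mulrC.
(* Centring opens the way to (Dec): [c k] is the mean of [step s] for the density [h k]. *)
have F0 k : \int[mu]_(x in I) F k x = 0.
  transitivity (\int[mu]_(x in I) (h k x * step s x - c k * h k x)).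
    by apply: eq_Rintegral => x _; rewrite /F /phi; ring.
  rewrite (@RintegralB _ _ _ mu I)//; last first.
  - exact: L1Z.
  - exact: L1M (bounded_meas_step s).
  rewrite (@RintegralZl _ _ _ mu I)//; last exact: h_L1.
  rewrite [X in c k * X](_ : _ = 1); last exact: h_int.
  by rewrite mulr1 h_orbit ?subrr//; exact: bounded_meas_step.
have FD k : (BVnorm (F k) < (2 * D)%:E)%E.
  apply: BVnormM => //; exact: total_variation_step.
pose G k x := \sum_(0 <= j < k) Q j (k - j) (F j) x.
(* [F k] is the term j = k, where [Q k 0] is the identity; one more transfer raises every exponent
   by one. *)
have G_transfers k : transfers (Ts k.+1) (fun x => G k x + F k x) (G k.+1).
  have -> : (fun x => G k x + F k x) = (fun x => \sum_(0 <= j < k.+1) Q j (k - j) (F j) x).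
    by apply/funext => x; rewrite big_nat_recr//= subnn.
  apply: transfers_sum => // j jk; rewrite subSn//.
  by have := Q_transfers j (k - j) (LF j); rewrite subnKC.
have LG k : L1 (G k).
  case: k => [|k]; last by have [] := G_transfers k.
  have -> : G 0%N = cst 0 by apply/funext => x; rewrite /G big_nil.
  exact/L1_bounded/bounded_meas_cst.
have G_bound k : {ae mu, forall x, I x -> `|G k x| <= B0}.
  apply: ae_I1 (ae_sum_bound (c := fun j => theta ^+ (k - j) * (K * (2 * D))) _) => [x _ /le_trans|].
    apply; rewrite -mulr_suml ler_wpM2r ?sum_geometric_le//.
    by rewrite mulr_ge0//; lra.
  by move=> j jk; apply: HQ => //; rewrite subn_gt0.
(* A version of the density bounded below at every point, so that dividing by it is safe
   everywhere. *)
pose hp k x := Num.max delta (h k x).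
have hp_ge k x : delta <= hp k x by rewrite /hp le_max lexx.
have hp_gt0 k x : 0 < hp k x by exact: lt_le_trans (hp_ge k x).
have mhp k : measurable_fun I (hp k).
  by apply: measurable_maxr; [exact: measurable_cst|exact: L1_measurable].
have hpE k : {ae mu, forall x, I x -> h k x = hp k x}.
  by apply: ae_I1 (hd k) => x _ hx; rewrite /hp max_r.
have hp_transfers k : transfers (Ts k.+1) (hp k) (hp k.+1).
  exact: transfers_ae (h_transfers k) (mhp k) (mhp k.+1) (hpE k) (hpE k.+1).
(* The quotient is bounded by [B] only a.e.; the truncation makes the increments [psi k] bounded at
   every point. *)
pose H k x := clamp B (G k x * (hp k x)^-1).
have bH k : bounded_meas (H k).
  apply: bounded_meas_clamp => //; apply: measurable_funM; first exact: L1_measurable.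
  by apply: inv_max_measurable => //; exact: L1_measurable.
have H_bound k x : `|H k x| <= B by exact: clamp_bound.
have hpH k : {ae mu, forall x, I x -> G k x = hp k x * H k x}.
  apply: ae_I1 (G_bound k) => x _ Gx; rewrite /H clamp_id.
    by rewrite mulrCA divff ?mulr1// gt_eqF.
  rewrite normrM ler_pM// ger0_norm ?invr_ge0 ?(ltW (hp_gt0 k x))//.
  by rewrite lef_pV2 ?posrE.
pose psi k x := phi k x + H k x - H k.+1 (Ts k.+1 x).
have bHT k : bounded_meas (fun x => H k.+1 (Ts k.+1 x)).
  exact: (selfmap_comp (Ts_selfmap k)).
have bpsi k : bounded_meas (psi k).
  by apply: bounded_measD; [exact: bounded_measD|exact: bounded_measN].
have psi_bound k x : `|psi k x| <= 1 + 2 * B.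
  have := phi1 k x; have := H_bound k x; have := H_bound k.+1 (Ts k.+1 x).
  by rewrite !ler_norml => /andP[? ?] /andP[? ?] /andP[? ?]; rewrite /psi; lra.
(* Both hp_k (phi_k + H_k) and hp_k (H_{k+1} o T_{k+1}) have transfer hp_{k+1} H_{k+1}: the first by
   the recursion for G, the second by the module property. Their difference is hp_k psi_k. *)
have psi0 k u : bounded_meas u ->
    \int[mu]_(x in I) (hp k x * psi k x * u (Ts k.+1 x)) = 0.
  move=> bu; have [Lhp _ _] := hp_transfers k.
  have buT := selfmap_comp (Ts_selfmap k) bu.
  have b1 : bounded_meas (fun x => phi k x + H k x) by exact: bounded_measD.
  have [_ _ E1] := transfersM (Ts_selfmap k) (bH k.+1) (hp_transfers k).
  have [_ _ E2] : transfers (Ts k.+1) (fun x => hp k x * (phi k x + H k x))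
      (fun x => hp k.+1 x * H k.+1 x).
    apply: (transfers_ae (Ts_selfmap k) (G_transfers k)).
    - by apply: measurable_funM => //; case: b1.
    - by apply: measurable_funM => //; case: (bH k.+1).
    - apply: ae_I2 (hpE k) (hpH k) => x _ hx Gx.
      by rewrite Gx /F hx; ring.
    - exact: hpH.
  transitivity (\int[mu]_(x in I) (hp k x * (phi k x + H k x) * u (Ts k.+1 x) -
      hp k x * H k.+1 (Ts k.+1 x) * u (Ts k.+1 x))).
    by apply: eq_Rintegral => x _; rewrite /psi; ring.
  rewrite (@RintegralB _ _ _ mu I)//; last first.
  - by apply: L1M => //; exact: L1M.
  - by apply: L1M => //; exact: L1M.
  by rewrite -E1// -E2// subrr.
have mgf := reverse_martingale_mgf n lam Ts_selfmap bpsi (fun k x _ => psi_bound k x)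
  (fun k x _ => ltW (hp_gt0 k x)) hp_transfers psi0.
(* The weights disappear at both ends: [hp 0] is 1 because delta <= 1, and [h n] has integral 1. *)
have {}mgf : \int[mu]_(x in I) expR (lam * \sum_(0 <= k < n) psi k (Tcomp Ts 1 k x)) <=
    expR (2 * (lam * (1 + 2 * B)) ^+ 2 * n%:R).
  apply: le_trans (le_trans mgf _).
    rewrite le_eqVlt; apply/orP; left; apply/eqP; apply: eq_Rintegral => x _.
    by rewrite /hp /h /= max_r// mul1r.
  rewrite -[leRHS]mulr1 -[X in _ <= _ * X](h_int n) ler_wpM2l ?expR_ge0//.
  rewrite le_eqVlt; apply/orP; left; apply/eqP; apply: ae_Rintegral => //.
    exact: L1_measurable.
  by apply: ae_I1 (hpE n) => x _ ->.
(* Only the final coboundary term survives, since [G 0] is an empty sum. *)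
have telescope m x : \sum_(0 <= k < m) psi k (Tcomp Ts 1 k x) =
    \sum_(0 <= k < m) phi k (Tcomp Ts 1 k x) - H m (Tcomp Ts 1 m x).
  elim: m => [|m IH].
    by rewrite !big_nil /H /G big_nil mul0r clamp_id ?normr0// subrr.
  by rewrite !big_nat_recr//= IH TcompS /psi; ring.
have bsum (f : nat -> R -> R) : (forall k, bounded_meas (f k)) ->
    bounded_meas (fun x => expR (lam * \sum_(0 <= k < n) f k (Tcomp Ts 1 k x))).
  move=> bf; apply: bounded_meas_expR; apply: bounded_measM; first exact: bounded_meas_cst.
  by apply: bounded_meas_sum => k; exact: (selfmap_comp (oT k)).
rewrite expRD; apply: le_trans (ler_wpM2l (expR_ge0 _) mgf).
rewrite -(@RintegralZl _ _ _ mu I)//; last exact/L1_bounded/bsum.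
apply: (@le_Rintegral _ _ _ mu I) => //.
- exact/L1_bounded/(bsum phi).
- exact/L1Z/L1_bounded/bsum.
move=> x _; rewrite -expRD ler_expR telescope mulrBr.
have : lam * H n (Tcomp Ts 1 n x) <= `|lam| * B.
  by rewrite (le_trans (ler_norm _))// normrM ler_wpM2l.
rewrite /phi; lra.
Qed.

End Decomposition.

(** * From exponential moments to the Kantorovich distance *)

Section Concentration.
Context {R : realType}.
Implicit Types (T : R -> R) (Ts : nat -> R -> R).

Local Notation I := (I01 : set R).
Local Notation mu := (@lebesgue_measure R).
Local Notation TR := (measurableTypeR R).

Lemma empirical_cdf Ts n x s : (forall k, I (Tcomp Ts 1 k x)) ->
  empirical Ts n x `[0, s]%classic =
  (n%:R^-1 * \sum_(0 <= k < n) step s (Tcomp Ts 1 k x))%:E.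
Proof.
move=> IT; rewrite /empirical EFinM -sumEFin; congr (_ * _)%E.
apply: eq_bigr => k _; rewrite diracE /step; congr (_%:R)%:E.
rewrite mem_setE in_itv/=.
by have /=/[!in_itv]/=/andP[-> _] := IT k.
Qed.

Lemma pushforward_cdf T s : selfmap T ->
  pushforward m T `[0, s]%classic = (\int[mu]_(y in I) step s (T y))%:E.
Proof.
move=> sT; rewrite -L1_RintegralE; last exact/L1_bounded/(selfmap_comp sT)/bounded_meas_step.
rewrite /pushforward /m /mrestr.
have mE : measurable (I `&` T @^-1` `[0, s]%classic) by exact: sT.1.
have -> : T @^-1` `[0, s]%classic `&` I = (I `&` T @^-1` `[0, s]%classic) `&` I.
  by rewrite [in RHS]setIC setIA setIid setIC.
rewrite -(@integral_indic _ _ _ mu I measurable_I _ mE).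
apply: eq_integral => x /set_mem Ix; rewrite indicE /step; congr (_%:R)%:E.
have /=/[!in_itv]/=/andP[T0 _] := sT.2 _ Ix.
congr nat_of_bool; apply/idP/idP => [/set_mem[_ /=]|Ts]; first by rewrite in_itv/= => /andP[].
by apply/mem_set; split => //=; rewrite in_itv/= T0.
Qed.

Lemma mean_law_cdf Ts n s : (forall k, selfmap (Tcomp Ts 1 k)) ->
  mean_law Ts n `[0, s]%classic =
  (n%:R^-1 * \sum_(0 <= k < n) \int[mu]_(y in I) step s (Tcomp Ts 1 k y))%:E.
Proof.
move=> sT; rewrite /mean_law EFinM -sumEFin; congr (_ * _)%E.
by apply: eq_bigr => k _; exact: pushforward_cdf.
Qed.

Lemma kantorovich_empirical Ts n x : (forall k, selfmap (Tcomp Ts 1 k)) -> I x ->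
  kantorovich (empirical Ts n x) (mean_law Ts n) =
  (\int[mu]_(s in I) (`|n%:R^-1 * \sum_(0 <= k < n) (step s (Tcomp Ts 1 k x) -
     \int[mu]_(y in I) step s (Tcomp Ts 1 k y))|)%:E)%E.
Proof.
move=> sT Ix; apply: eq_integral => s _.
rewrite empirical_cdf//; last by move=> k; exact: (sT k).2.
by rewrite mean_law_cdf// -EFinB abse_EFin -mulrBr sumrB.
Qed.

Lemma integral_indicI (f : TR -> R) :
  (\int[mu]_s (f s * \1_I s)%:E = \int[mu]_(s in I) (f s)%:E)%E.
Proof.
rewrite [RHS]integral_mkcond; apply: eq_integral => s _.
by rewrite patchE indicE; case: (s \in I); rewrite ?mulr1 ?mulr0.
Qed.

(* Markov's inequality for the exponential moment averaged over the parameter;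
   Jensen's inequality enters through the tangent line of [expR] at [lam * u]. *)
Lemma averaged_chernoff (S : R -> R -> R) (lam u E M : R) :
  measurable_fun setT (fun p : TR * TR => S p.1 p.2) ->
  (forall x s, `|S x s| <= M) -> 0 <= lam ->
  (forall s, \int[mu]_(x in I) expR (lam * `|S x s|) <= E) ->
  (mu ([set x | u%:E < \int[mu]_(s in I) `|S x s|%:E] `&` I) <=
    (E * expR (- (lam * u)))%:E)%E.
Proof.
move=> mS SM lam0 SE.
have SM2 : measurable_fun setT (fun p : TR * TR => expR (lam * `|S p.1 p.2|)).
  apply: measurableT_comp => //; apply: measurable_funM => //.
  exact: measurableT_comp.
have bnorm (f : R -> R) : measurable_fun setT (f : TR -> R) -> (forall x, `|f x| <= M) ->
    bounded_meas (fun x => `|f x|).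
  move=> mf fM; split; last by exists M => x _; rewrite normr_id.
  by apply: measurableT_comp => //; exact: measurable_funTS.
have bexp (f : R -> R) : measurable_fun setT (f : TR -> R) -> (forall x, `|f x| <= M) ->
    bounded_meas (fun x => expR (lam * `|f x|)).
  move=> mf fM; apply: bounded_meas_expR; apply: bounded_measM.
    exact: bounded_meas_cst.
  exact: bnorm.
have Sx x : measurable_fun setT (S x : TR -> R).
  exact: (measurableT_comp mS (measurable_pair1 x)).
have Ss s : measurable_fun setT (S ^~ s : TR -> R).
  exact: (measurableT_comp mS (measurable_pair2 s)).
(* The restrictions to [I] become factors of the integrand, so that Tonelli applies to Lebesgue
   measure on the whole line in both variables. *)
pose f (p : TR * TR) := (expR (lam * `|S p.1 p.2|) * (\1_I p.1 * \1_I p.2))%:E.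
have m1 : measurable_fun setT (\1_I : TR -> R) by exact: measurable_indic.
have mf : measurable_fun setT f.
  apply/measurable_EFinP; apply: measurable_funM => //.
  apply: measurable_funM.
  - exact: (measurableT_comp m1 measurable_fst).
  - exact: (measurableT_comp m1 measurable_snd).
have f0 p : (0 <= f p)%E.
  by rewrite lee_fin mulr_ge0 ?expR_ge0// mulr_ge0// indicE.
pose G (x : TR) := (\int[mu]_s f (x, s))%E.
have mG : measurable_fun setT G by exact: (measurable_fun_fubini_tonelli_F f mf f0).
have G0 x : (0 <= G x)%E by exact: integral_ge0.
have intG : (\int[mu]_x G x <= E%:E)%E.
  rewrite (fubini_tonelli f mf f0).
  apply: (@le_trans _ _ (\int[mu]_s (E * \1_I s)%:E)%E).
    apply: ge0_le_integral => //.
    - by move=> s _; exact: integral_ge0.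
    - exact: (measurable_fun_fubini_tonelli_G f mf f0).
    - by apply/measurable_EFinP; exact: (measurable_funM (measurable_cst E) m1).
    move=> s _; rewrite [leLHS](_ : _ =
        \int[mu]_x ((expR (lam * `|S x s|) * \1_I s) * \1_I x)%:E)%E; last first.
      by apply: eq_integral => x _; rewrite /f/=; congr EFin; ring.
    rewrite integral_indicI L1_RintegralE; last first.
      by apply: L1M (bounded_meas_cst _); apply: L1_bounded; exact: bexp.
    rewrite lee_fin (@RintegralZr _ _ _ mu I)//; last by apply: L1_bounded; exact: bexp.
    by rewrite ler_wpM2r// indicE.
  rewrite integral_indicI L1_RintegralE; last exact/L1_bounded/bounded_meas_cst.
  by rewrite Rintegral_cstI.
set e := expR (lam * u).
have e0 : 0 < e by exact: expR_gt0.
have mA : measurable [set x : TR | (e%:E <= G x)%E].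
  rewrite -[X in measurable X]setTI; exact: emeasurable_fun_c_infty.
apply: (@le_trans _ _ (mu [set x : TR | (e%:E <= G x)%E])).
  (* Lebesgue measure is here an outer measure on all sets, so monotonicity needs measurability only
     of the larger set used afterwards. *)
  apply: le_mu_ext => x [/= ux Ix].
  have -> : G x = (\int[mu]_(s in I) expR (lam * `|S x s|))%:E.
    rewrite -L1_RintegralE; last by apply: L1_bounded; exact: (bexp (S x)).
    rewrite -integral_indicI; apply: eq_integral => s _; rewrite /f/=.
    by rewrite [\1_I x]indicE mem_set// mul1r.
  have LS : L1 (fun s => `|S x s|) by apply: L1_bounded; exact: (bnorm (S x)).
  move: ux; rewrite L1_RintegralE// !lee_fin !lte_fin => ux.
  apply: (@le_trans _ _ (\int[mu]_(s in I) (e * (1 - lam * u) + e * lam * `|S x s|))).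
    rewrite (@RintegralD _ _ _ mu I)//; last 2 first.
    - exact/L1_bounded/bounded_meas_cst.
    - exact: L1Z.
    rewrite Rintegral_cstI (@RintegralZl _ _ _ mu I)//.
    have : 0 <= e * lam * (\int[mu]_(s in I) `|S x s| - u).
      by rewrite !mulr_ge0 ?(ltW e0)// subr_ge0 ltW.
    lra.
  apply: (@le_Rintegral _ _ _ mu I) => //.
  - by apply: L1D; [exact/L1_bounded/bounded_meas_cst|exact: L1Z].
  - by apply: L1_bounded; exact: (bexp (S x)).
  move=> s _; have -> : lam * `|S x s| = lam * u + (lam * `|S x s| - lam * u) by ring.
  rewrite expRD -/e.
  have := ler_wpM2l (ltW e0) (expR_ge1Dx (lam * `|S x s| - lam * u)); lra.
have : (e%:E * mu [set x : TR | (e%:E <= G x)%E] <= E%:E)%E.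
  apply: le_trans intG; rewrite -integral_cst//.
  apply: (@le_trans _ _ (\int[mu]_(x in [set x : TR | (e%:E <= G x)%E]) G x)%E).
    apply: ge0_le_integral => //.
    - by move=> x _; rewrite lee_fin ltW.
    - exact: measurable_funTS.
  by apply: ge0_subset_integral.
rewrite expRN -/e EFinM muleC => H.
by rewrite lee_pdivlMr// muleC.
Qed.

(** Joint measurability for Tonelli; [T] is extended by 0 because nothing is known of it off [I]. *)
Lemma measurable_step_orbit T : measurable_fun I T ->
  measurable_fun setT (fun p : TR * TR => step p.2 ((T \_ I) p.1)).
Proof.
move=> mT; have mT0 : measurable_fun setT (T \_ I : TR -> TR).
  by exact/(measurable_restrictT _ measurable_I).
rewrite /step.
have -> : (fun p : TR * TR => ((T \_ I) p.1 <= p.2)%R%:R) =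
    (fun p : TR * TR => if (T \_ I) p.1 <= p.2 then 1 else 0 : R).
  by apply/funext => p; case: (_ <= _).
apply: measurable_fun_ifT => //.
apply: measurable_fun_ler => //.
exact: (measurableT_comp mT0 measurable_fst).
Qed.

Lemma measurable_mean_step T : selfmap T ->
  measurable_fun setT (fun s : TR => \int[mu]_(y in I) step s (T y) : R).
Proof.
move=> sT; apply: nondecreasing_measurable => // s s' ss'.
apply: (@le_Rintegral _ _ _ mu I) => //.
- exact/L1_bounded/(selfmap_comp sT)/bounded_meas_step.
- exact/L1_bounded/(selfmap_comp sT)/bounded_meas_step.
move=> x _; rewrite /step ler_nat.
by case: (leP (T x) s) => // Txs; rewrite (le_trans Txs ss').
Qed.

End Concentration.

Theorem proposition14 (R : realType) (C : set (R -> R)) (r : nat)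
    (Ts : nat -> R -> R) :
  (forall T, C T -> piecewise_expanding T) ->
  (1 <= r)%N -> Dr r C -> Dec C ->
  (forall n, (1 <= n)%N -> C (Ts n)) ->
  Min Ts ->
  exists2 c : R, 0 < c &
    forall (t : R) (n : nat), 0 < t -> (1 <= n)%N ->
      (m [set x | ((t / Num.sqrt n%:R)%:E <
                   kantorovich (empirical Ts n x) (mean_law Ts n))%E]
       <= (2 * expR (- (c * t ^+ 2)))%:E)%E.
Proof.
move=> expC r1 DrC DecC TsC MinTs.
have [B B0 mgf] := orbit_mgf expC r1 DrC DecC TsC MinTs.
have oT k : selfmap (Tcomp Ts 1 k).
  by apply: Tcomp_selfmap => i; apply/piecewise_expanding_selfmap/expC/TsC.
pose q : R := ((1 + 2 * B) ^+ 2)^-1.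
have q0 : 0 < q by rewrite invr_gt0 exprn_gt0//; lra.
have qb : q * (1 + 2 * B) ^+ 2 = 1 by rewrite mulVf// gt_eqF// exprn_gt0//; lra.
have qB : q * B ^+ 2 <= 4^-1.
  have : q * (4 * B ^+ 2) <= q * (1 + 2 * B) ^+ 2 by rewrite ler_wpM2l ?ltW//; nra.
  by rewrite qb; lra.
exists (q / 32) => [|t n t0 n1]; first by rewrite divr_gt0.
set A := [set x | _].
have [tB|Bt] := ltP t (4 * B).
  (* For t < 4B one has q t^2 <= 16 q B^2 <= 4, so the right-hand side is at least 2 (1 - 1/8),
     above the total mass 1. *)
  apply: (@le_trans _ _ 1%E).
    rewrite -[leRHS](@mu_I R) /m /mrestr.
    by apply: le_mu_ext => x [].
  rewrite lee_fin.
  have t2 : q * t ^+ 2 <= q * (16 * B ^+ 2) by rewrite ler_wpM2l ?ltW//; nra.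
  have := expR_ge1Dx (- (q / 32 * t ^+ 2)); lra.
have n0 : 0 < n%:R :> R by rewrite ltr0n.
set w := Num.sqrt n%:R in A *.
have nV0 : 0 <= n%:R^-1 :> R by rewrite invr_ge0 ltW.
have w1 : 1 <= w by rewrite -[leLHS]sqrtr1 ler_wsqrtr// ler1n.
have w0 : 0 < w by exact: lt_le_trans w1.
have w2 : w ^+ 2 = n%:R by rewrite sqr_sqrtr// ltW.
pose c k s : R := \int[leb]_(y in I01) step s (Tcomp Ts 1 k y).
pose S (x s : R) : R :=
  n%:R^-1 * \sum_(0 <= k < n) (step s ((Tcomp Ts 1 k \_ I01) x) - c k s).
(* The minimiser of 2 (lam (1 + 2B))^2 n - lam n t / w, with minimum -q t^2 / 8. The prefactor will
   cost at most q t^2 / 16, which leaves room for the exponent q t^2 / 32. *)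
have [lam lamE] : exists lam, lam = q / 4 * t / w by eexists.
have lam0 : 0 <= lam by rewrite lamE divr_ge0 ?mulr_ge0// ?ltW// divr_gt0.
have SE x s : (I01 : set R) x -> S x s = n%:R^-1 * \sum_(0 <= k < n) (step s (Tcomp Ts 1 k x) - c k s).
  move=> Ix; congr (_ * _); apply: eq_bigr => k _.
  by rewrite patchE mem_set.
have c01 k s : 0 <= c k s <= 1 by exact: mean_step_bound.
have S1 x s : `|S x s| <= 1.
  rewrite /S normrM (ger0_norm nV0) ler_pdivrMl// mulr1.
  rewrite (le_trans (ler_norm_sum _ _ _))//.
  rewrite -[leRHS](_ : \sum_(0 <= k < n) 1 = n%:R); last first.
    by rewrite big_const_nat subn0 iter_addr addr0.
  apply: ler_sum => k _; rewrite ler_norml.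
  have /andP[] := step_bound s ((Tcomp Ts 1 k \_ I01) x).
  by have /andP[] := c01 k s; lra.
have mS : measurable_fun setT
    (fun p : measurableTypeR R * measurableTypeR R => S p.1 p.2).
  apply: measurable_funM => //; apply: measurable_sum => k.
  apply: measurable_funB; first exact: measurable_step_orbit (oT k).1.
  exact: (measurableT_comp (measurable_mean_step (oT k)) measurable_snd).
have bS s : bounded_meas (S ^~ s).
  split; last by exists 1.
  exact: measurable_funTS (measurableT_comp mS (measurable_pair2 s)).
(* The absolute value is removed by e^|y| <= e^y + e^(-y), using the moment bound at both signs of
   [lam]; this is the factor 2 of the theorem. *)
have Smgf s : \int[leb]_(x in I01) expR (lam * n%:R * `|S x s|) <=
    2 * expR (lam * B + 2 * (lam * (1 + 2 * B)) ^+ 2 * n%:R).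
  have LS (l : R) : L1 (fun x => expR (l * S x s)).
    apply/L1_bounded/bounded_meas_expR/bounded_measM => //.
    exact: bounded_meas_cst.
  have one (l : R) : `|l| = lam -> \int[leb]_(x in I01) expR (l * n%:R * S x s) <=
      expR (lam * B + 2 * (lam * (1 + 2 * B)) ^+ 2 * n%:R).
    move=> lE; have := mgf s l n; rewrite lE.
    have -> : (l * (1 + 2 * B)) ^+ 2 = (lam * (1 + 2 * B)) ^+ 2.
      by rewrite !exprMn -lE real_normK ?num_real.
    apply: le_trans; rewrite le_eqVlt; apply/orP; left; apply/eqP.
    apply: eq_Rintegral => x /set_mem Ix; rewrite SE// mulrA mulfK ?gt_eqF//.
  have lp := one lam (ger0_norm lam0).
  have lm : `|- lam| = lam by rewrite normrN ger0_norm.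
  apply: (@le_trans _ _ (\int[leb]_(x in I01)
      (expR (lam * n%:R * S x s) + expR (- lam * n%:R * S x s)))); last first.
    rewrite (@RintegralD _ _ _ leb I01)//; [|exact: LS..].
    by have := one (- lam) lm; lra.
  apply: (@le_Rintegral _ _ _ leb I01) => //.
  - have bnS : bounded_meas (fun x => `|S x s|).
      by split; [apply: measurableT_comp => //; case: (bS s)|exists 1 => x _; rewrite normr_id].
    apply/L1_bounded/bounded_meas_expR/bounded_measM => //.
    exact: bounded_meas_cst.
  - by apply: L1D; exact: LS.
  move=> x _; case: (ger0P (S x s)) => _.
    by rewrite lerDl expR_ge0.
  by rewrite mulrN !mulNr lerDr expR_ge0.
have chern := averaged_chernoff (t / w) mS S1
  (mulr_ge0 lam0 (ltW n0)) Smgf.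
apply: (@le_trans _ _ (leb ([set x | ((t / w)%:E <
    \int[leb]_(s in I01) `|S x s|%:E)%E] `&` I01))).
  apply: le_mu_ext => x [Ax Ix]; split => //.
  move: Ax; rewrite /A /= kantorovich_empirical//.
  by under [X in (_ < X)%E -> _]eq_integral => s _ do rewrite -/(c _ _) -SE//.
apply: (le_trans chern); rewrite lee_fin -mulrA ler_pM2l// -expRD ler_expR.
have w_neq0 : w != 0 by rewrite gt_eqF.
have -> : lam * n%:R * (t / w) = q * t ^+ 2 / 4.
  by rewrite lamE -w2; field.
have -> : 2 * (lam * (1 + 2 * B)) ^+ 2 * n%:R = q * t ^+ 2 / 8.
  transitivity (q * (1 + 2 * B) ^+ 2 * (q * t ^+ 2 / 8)).
    by rewrite lamE -w2; field.
  by rewrite qb mul1r.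
(* Here 4B <= t and w >= 1 absorb the coboundary prefactor. *)
have lamB : lam * B <= q * t ^+ 2 / 16.
  have lam_le : lam <= q / 4 * t.
    by rewrite lamE ler_pdivrMr// ler_peMr// mulr_ge0 ?ltW// divr_gt0.
  apply: (le_trans (ler_wpM2r B0 lam_le)).
  have : q * t * (4 * B) <= q * t * t by rewrite ler_wpM2l// mulr_ge0 ?ltW.
  lra.
have : 0 <= q * t ^+ 2 by rewrite mulr_ge0 ?exprn_ge0 ?ltW.
lra.
Qed.
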